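(* Let $M$ be a smooth manifold, $Q$ a principal $\mathrm{SO}(2)$-bundle over $M$, and $L=Q\times_{\mathrm{SO}(2)}\mathbb{R}^2$ its associated Hermitian line bundle. Then the categories $\mathrm{Prin}(M,\mathrm{Spin}_2)/Q$, $\sqrt[H]{L}$, and $\sqrt{L}$ are equivalent. If $M$ is a complex manifold and $L$ is given a holomorphic structure, then these categories are also equivalent to $\sqrt[\mathrm{hol}]{L}$.
   Context: $\mathrm{Spin}_2\to\mathrm{SO}(2)$ is the connected two-sheeted covering group; identifying both groups with $\mathbb{T}=\{z\in\mathbb{C}:|z|=1\}$, it is $z\mapsto z^2$. With $\mathbb{R}^2=\mathbb{C}$ and $\mathrm{SO}(2)=\mathrm{U}(1)$, $L$ is a complex line bundle with a Hermitian metric. - $\mathrm{Prin}(M,\mathrm{Spin}_2)/Q$ is the category of spin structures on $Q$: objects are $\mathrm{Spin}_2$-reductions of $Q$, i.e. principal $\mathrm{Spin}_2$-bundles $P$ over $M$ with a bundle map $P\to Q$ over $M$ that is equivariant along $\mathrm{Spin}_2\to\mathrm{SO}(2)$; morphisms are isomorphisms of principal $\mathrm{Spin}_2$-bundles $P\to P'$ commuting with the maps to $Q$. - $\sqrt[H]{L}$ is the category of Hermitian square roots of $L$: objects are Hermitian line bundles $N$ over $M$ with a smooth surjective bundle map $N\to L$ over $M$ that is complex-quadratic on each fiber and sends unit vectors to unit vectors; morphisms are smooth unitary isomorphisms $N\to N'$ of line bundles commuting with the maps to $L$. - $\sqrt{L}$ is the category of smooth square roots of $L$: objects are smooth complex line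 bundles $N$ over $M$ with a smooth surjective bundle map $N\to L$ over $M$ that is complex-quadratic on each fiber; morphisms are smooth isomorphisms of complex line bundles commuting with the maps to $L$. - If $M$ is a complex manifold and $L$ is a holomorphic line bundle, $\sqrt[\mathrm{hol}]{L}$ is the category of holomorphic square roots of $L$: objects are holomorphic line bundles $N$ over $M$ with a holomorphic surjective bundle map $N\to L$ over $M$ that is complex-quadratic on each fiber; morphisms are holomorphic isomorphisms of line bundles commuting with the maps to $L$. A holomorphic structure on $L$ means one compatible with its given structure of a smooth complex line bundle. *)

(* Defs.v *)
From HB Require Import structures.
From mathcomp Require Import all_boot all_order all_algebra.
From mathcomp Require Import generic_quotient.
From mathcomp Require Import ring.
From mathcomp Require Import all_classical all_reals all_analysis.
From mathcomp Require Import complex.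
Set Implicit Arguments.
Unset Strict Implicit.
Unset Printing Implicit Defensive.
Import Order.TTheory GRing.Theory Num.Theory numFieldNormedType.Exports.
Local Open Scope classical_set_scope.
Local Open Scope ring_scope.

Section Smooth.
Variables (R : realType) (V W : normedModType R).

(* Frechet differentiability plus continuity of all iterated directional
   derivatives; this is the usual notion for open D in finite dimension *)
Fixpoint Ck (k : nat) (D : set V) (f : V -> W) : Prop :=
  if k is k'.+1 then
    (forall x, D x -> differentiable f x) /\ (forall v, Ck k' D ('D_v f))
  else forall x, D x -> {for x, continuous f}.

Definition smooth (D : set V) (f : V -> W) := forall k, Ck k D f.

Lemma Ck_point k (D : set V) f :
  (forall x, D x -> exists2 D', D' x & Ck k D' f) -> Ck k D f.
Proof.
elim: k f => [|k IH] f /= h.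
  by move=> x /h[D' D'x h']; exact: h'.
split=> [x /h[D' D'x [h' _]]|v]; first exact: h'.
by apply: IH => x /h[D' D'x [_ h']]; exists D'.
Qed.

Lemma Ck_sub k (D D' : set V) f : D `<=` D' -> Ck k D' f -> Ck k D f.
Proof. by move=> s h; apply: Ck_point => x /s ?; exists D'. Qed.

Lemma differentiable_near (f g : V -> W) (x : V) :
  {near x, f =1 g} -> differentiable f x -> differentiable g x.
Proof.
move=> fg df.
have h0 : differentiable (g - f) x.
  have E : (g - f) \o shift x =
      cst ((g - f) x) + (\0 : {linear V -> W}) +o_ 0 id.
    have fg0 : \forall h \near (0 : V), f (h + x) = g (h + x).
      by rewrite (near_shift x) /=; near do rewrite /= sub0r addrNK.
    apply/eqaddoP => _/posnumP[e]; near=> h.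
    rewrite !fctE /= (nbhs_singleton fg) subrr addr0 subr0.
    have -> : f (h + x) = g (h + x) by near: h.
    by rewrite subrr normr0 mulr_ge0.
  have c0 : continuous (\0 : {linear V -> W})
    by move=> y; apply: (@cst_continuous V W 0 y).
  have d0 := diff_unique c0 E.
  apply/diff_locallyP; rewrite d0; split=> //.
have -> : g = f + (g - f) by apply/funext => y; rewrite !fctE /= addrC subrK.
exact: differentiableD.
Unshelve. all: by end_near. Qed.

Lemma Ck_congr k (D : set V) f g : open D -> (forall x, D x -> f x = g x) ->
  Ck k D f -> Ck k D g.
Proof.
move=> oD; elim: k f g => [|k IH] f g fg /=.
  move=> h x Dx; have := h x Dx.
  rewrite /prop_for /continuous_at -(fg x Dx) => hx.
  apply: cvg_trans hx; apply: near_eq_cvg.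
  by near=> y; apply: fg; near: y; exact: open_nbhs_nbhs.
move=> [hd hk]; split=> [x Dx|v].
  apply: differentiable_near (hd x Dx).
  by near=> y; apply: fg; near: y; exact: open_nbhs_nbhs.
apply: IH (hk v) => x Dx; apply: near_eq_derive.
by near=> y; apply: fg; near: y; exact: open_nbhs_nbhs.
Unshelve. all: by end_near. Qed.

Lemma CkS k (D : set V) f : Ck k.+1 D f -> Ck k D f.
Proof.
elim: k f => [|k IH] f /= [h1 h2].
  by move=> x /h1 /differentiable_continuous.
by split=> // v; apply: IH.
Qed.

Lemma Ck_cst k (D : set V) (w : W) : Ck k D (cst w).
Proof.
elim: k w => [|k IH] w /=; first by move=> x _; exact: cst_continuous.
split=> [x _|v]; first exact: differentiable_cst.
have -> : 'D_v (cst w : V -> W) = cst 0 by apply/funext=> x; exact: derive_cst.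
exact: IH.
Qed.

End Smooth.

Section SmoothOps.
Variables (R : realType) (V : normedModType R).

Lemma CkD (W : normedModType R) k (D : set V) (f g : V -> W) : open D ->
  Ck k D f -> Ck k D g -> Ck k D (f + g).
Proof.
move=> oD; elim: k f g => [|k IH] f g /=.
  by move=> hf hg x Dx; apply: continuousD; [exact: hf|exact: hg].
move=> [f1 f2] [g1 g2]; split=> [x Dx|v].
  by apply: differentiableD; [exact: f1|exact: g1].
apply: Ck_congr (IH _ _ (f2 v) (g2 v)) => // x Dx.
by rewrite deriveD //; apply: diff_derivable; [exact: f1|exact: g1].
Qed.

Lemma CkN (W : normedModType R) k (D : set V) (f : V -> W) : open D ->
  Ck k D f -> Ck k D (- f).
Proof.
move=> oD; elim: k f => [|k IH] f /=.
  by move=> hf x Dx; apply: continuousN; exact: hf.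
move=> [f1 f2]; split=> [x Dx|v]; first by apply: differentiableN; exact: f1.
apply: Ck_congr (IH _ (f2 v)) => // x Dx.
by rewrite deriveN //; apply: diff_derivable; exact: f1.
Qed.

Lemma CkM k (D : set V) (f g : V -> R) : open D ->
  Ck k D f -> Ck k D g -> Ck k D (f * g).
Proof.
move=> oD; elim: k f g => [|k IH] f g.
  by move=> hf hg x Dx; apply: continuousM; [exact: hf|exact: hg].
move=> Hf Hg; have [f1 f2] := Hf; have [g1 g2] := Hg; split=> [x Dx|v].
  by apply: differentiableM; [exact: f1|exact: g1].
have /Ck_congr : Ck k D (f * 'D_v g + g * 'D_v f).
  apply: CkD => //; apply: IH.
  - exact: CkS Hf.
  - exact: g2.
  - exact: CkS Hg.
  - exact: f2.
apply=> // x Dx; rewrite deriveM //; apply: diff_derivable.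
  exact: f1.
exact: g1.
Qed.

Lemma fst_diff (W1 W2 : normedModType R) (p : W1 * W2) :
  differentiable (fst : W1 * W2 -> W1) p.
Proof.
have l : linear (fst : W1 * W2 -> W1) by [].
pose L : {linear (W1 * W2)%type -> W1} :=
  HB.pack (fst : W1 * W2 -> W1) (GRing.isLinear.Build _ _ _ _ _ l).
by apply: (@linear_differentiable _ _ _ L) => q; exact: cvg_fst.
Qed.

Lemma snd_diff (W1 W2 : normedModType R) (p : W1 * W2) :
  differentiable (snd : W1 * W2 -> W2) p.
Proof.
have l : linear (snd : W1 * W2 -> W2) by [].
pose L : {linear (W1 * W2)%type -> W2} :=
  HB.pack (snd : W1 * W2 -> W2) (GRing.isLinear.Build _ _ _ _ _ l).
by apply: (@linear_differentiable _ _ _ L) => q; exact: cvg_snd.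
Qed.

Lemma derive_pair (W1 W2 : normedModType R) (f : V -> W1 * W2) x v :
  differentiable f x ->
  'D_v f x = ('D_v (fst \o f) x, 'D_v (snd \o f) x).
Proof.
move=> df.
have d1 : differentiable (fst \o f) x.
  exact: differentiable_comp (@fst_diff _ _ _).
have d2 : differentiable (snd \o f) x.
  exact: differentiable_comp (@snd_diff _ _ _).
have fE : f = (fun y => ((fst \o f) y, (snd \o f) y)).
  by apply/funext=> y; rewrite /= -surjective_pairing.
by rewrite !deriveE // {1}fE diff_pair.
Qed.

Lemma Ck_pair (W1 W2 : normedModType R) k (D : set V) (f : V -> W1 * W2) :
  open D ->
  Ck k D f <-> Ck k D (fst \o f) /\ Ck k D (snd \o f).
Proof.
move=> oD; elim: k f => [|k IH] f.
  split=> [h|[h1 h2] x Dx].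
    split=> x Dx; apply: continuous_comp; (try by apply: h).
      by apply: differentiable_continuous; exact: fst_diff.
    by apply: differentiable_continuous; exact: snd_diff.
  have fE : f = (fun y => ((fst \o f) y, (snd \o f) y)).
    by apply/funext=> y; rewrite /= -surjective_pairing.
  by rewrite fE; apply: cvg_pair; [exact: h1|exact: h2].
split=> [[h1 h2]|[[f1 f2] [g1 g2]]].
  split; (split; [move=> x Dx|move=> v]).
  - by apply: differentiable_comp (@fst_diff _ _ _); exact: h1.
  - have [H _] := (IH _).1 (h2 v).
    by apply: Ck_congr H => // x Dx; rewrite /= derive_pair //; exact: h1.
  - by apply: differentiable_comp (@snd_diff _ _ _); exact: h1.
  - have [_ H] := (IH _).1 (h2 v).
    by apply: Ck_congr H => // x Dx; rewrite /= derive_pair //; exact: h1.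
have df x : D x -> differentiable f x.
  move=> Dx; have fE : f = (fun y => ((fst \o f) y, (snd \o f) y)).
    by apply/funext=> y; rewrite /= -surjective_pairing.
  by rewrite fE; apply: differentiable_pair; [exact: f1|exact: g1].
split=> // v; apply/IH; split.
  by apply: Ck_congr (f2 v) => // x Dx; rewrite /= derive_pair //; exact: df.
by apply: Ck_congr (g2 v) => // x Dx; rewrite /= derive_pair //; exact: df.
Qed.

End SmoothOps.

Section SmoothAffine.
Variables (R : realType) (U V W : normedModType R) (A B : U -> V).
Hypothesis AB : forall x v (h : R), A (h *: v + x) = h *: B v + A x.
Hypothesis dA : forall x, differentiable A x.

Lemma derive_affine (f : V -> W) x v : 'D_v (f \o A) x = 'D_(B v) f (A x).
Proof. by rewrite /derive; do 2 f_equal; apply/funext=> h /=; rewrite AB. Qed.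

Lemma Ck_affine k (D : set V) (f : V -> W) :
  Ck k D f -> Ck k (A @^-1` D) (f \o A).
Proof.
elim: k f => [|k IH] f /=.
  move=> h x Dx; apply: continuous_comp; last exact: h.
  exact: differentiable_continuous.
move=> [h1 h2]; split=> [x Dx|v].
  by apply: differentiable_comp; [exact: dA|exact: h1].
have -> : 'D_v (f \o A) = 'D_(B v) f \o A.
  by apply/funext=> x; exact: derive_affine.
exact: IH.
Qed.

End SmoothAffine.

Section Charts.
Variables (R : realType) (M : topologicalType) (E : normedModType R).

(* cinv is only meaningful on crng, cfun only on cdom *)
Record chart := Chart {
  cdom : set M;
  crng : set E;
  cfun : M -> E;
  cinv : E -> M;
  cdom_open : open cdom;
  crng_open : open crng;
  cfun_rng : forall x, cdom x -> crng (cfun x);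
  cinv_dom : forall y, crng y -> cdom (cinv y);
  cfunK : forall x, cdom x -> cinv (cfun x) = x;
  cinvK : forall y, crng y -> cfun (cinv y) = y;
  cfun_cts : forall x, cdom x -> {for x, continuous cfun};
  cinv_cts : forall y, crng y -> {for y, continuous cinv}
}.

End Charts.

Definition transition_dom (R : realType) (M : topologicalType)
    (E E' : normedModType R) (c : chart M E) (c' : chart M E') : set E :=
  [set y | crng c y /\ cdom c' (cinv c y)].

Record manifold (R : realType) (n : nat) := Manifold {
  mtop :> topologicalType;
  manifold_hausdorff : hausdorff_space mtop;
  manifold_second_countable : @second_countable mtop;
  atlas : set (chart mtop 'rV[R]_n);
  atlas_cover : forall x, exists2 c, atlas c & cdom c x;
  atlas_smooth : forall c c', atlas c -> atlas c' ->
    smooth (transition_dom c c') (cfun c' \o cinv c)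
}.
Arguments atlas {R n} _.

(* multiplication by i on V * V, where (a, b) stands for a + i b *)
Definition Jpair (V : zmodType) (p : V * V) : V * V := (- p.2, p.1).

(* C^oo with complex linear differential (Cauchy-Riemann equations) *)
Definition holomorphic (R : realType) (V W : normedModType R)
    (JV : V -> V) (JW : W -> W) (D : set V) (f : V -> W) :=
  smooth D f /\ forall x v, D x -> 'D_(JV v) f x = JW ('D_v f x).

(* C^m is 'rV[R]_m * 'rV[R]_m with Jpair; the complex charts are required to be
   compatible with the smooth atlas of M (so n = 2 m unless M is empty). *)
Record complex_structure (R : realType) (n : nat) (M : manifold R n) (m : nat) :=
  ComplexStructure {
  catlas : set (chart M ('rV[R]_m * 'rV[R]_m)%type);
  catlas_cover : forall x, exists2 c, catlas c & cdom c x;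
  catlas_holomorphic : forall c c', catlas c -> catlas c' ->
    holomorphic (@Jpair _) (@Jpair _) (transition_dom c c') (cfun c' \o cinv c);
  catlas_compat : forall c c', catlas c -> atlas M c' ->
    smooth (transition_dom c c') (cfun c' \o cinv c) /\
    smooth (transition_dom c' c) (cfun c \o cinv c')
}.
Arguments catlas {R n M m} _.

Section Circle.
Variable R : realType.

Record circle := Circle { cval :> R[i]; circleP : `|cval| == 1 }.
HB.instance Definition _ := [isSub for cval].
HB.instance Definition _ := [Choice of circle by <:].

Fact circle1_subproof : `|1 : R[i]| == 1. Proof. by rewrite normr1. Qed.
Fact circleM_subproof (g h : circle) : `|cval g * cval h| == 1.
Proof. by rewrite normrM (eqP (circleP g)) (eqP (circleP h)) mulr1. Qed.
Fact circleV_subproof (g : circle) : `|(cval g)^-1| == 1.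
Proof. by rewrite normfV (eqP (circleP g)) invr1. Qed.
Fact cis_subproof (t : R) : `|(cos t +i* sin t)%C| == 1.
Proof. by rewrite normc_def /= cos2Dsin2 sqrtr1. Qed.

Definition circle1 := Circle circle1_subproof.
Definition circleM g h := Circle (circleM_subproof g h).
Definition circleV g := Circle (circleV_subproof g).
Definition cis t := Circle (cis_subproof t).

Lemma cval_neq0 (g : circle) : cval g != 0.
Proof. by rewrite -normr_gt0 (eqP (circleP g)) ltr01. Qed.

Fact circleMA : associative circleM.
Proof. by move=> f g h; apply/val_inj; rewrite /= mulrA. Qed.
Fact circle1M : left_id circle1 circleM.
Proof. by move=> g; apply/val_inj; rewrite /= mul1r. Qed.
Fact circleM1 : right_id circle1 circleM.
Proof. by move=> g; apply/val_inj; rewrite /= mulr1. Qed.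
Fact circleVM : left_inverse circle1 circleV circleM.
Proof. by move=> g; apply/val_inj; rewrite /= mulVf // cval_neq0. Qed.
Fact circleMV : right_inverse circle1 circleV circleM.
Proof. by move=> g; apply/val_inj; rewrite /= divff // cval_neq0. Qed.

HB.instance Definition _ :=
  isGroup.Build circle circleMA circle1M circleM1 circleVM circleMV.

Lemma cvalM (g h : circle) : cval (g * h)%g = cval g * cval h. Proof. by []. Qed.
Lemma cval1 : cval 1%g = 1. Proof. by []. Qed.

End Circle.

Section Regularity.
Variables (R : realType).

Record fibre := Fibre { fcar :> Type; fval : fcar -> R[i]; fone : fcar }.
Definition line_fibre := @Fibre R[i] id 1.
Definition circle_fibre := @Fibre (circle R) (@cval R) (circle1 R).

(* A class of regular maps W * F -> C, for W open in M, instantiated below to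
   the smooth and to the holomorphic ones; F is a submanifold of C through fval.
   The axioms are closure properties used to compose bundle maps. *)
Record regularity (M : topologicalType) (F : fibre) := Regularity {
  regular :> set M -> (M -> F -> R[i]) -> Prop;
  regular_local : forall W f, open W ->
    (forall x, W x -> exists W' f', [/\ open W', W' x, regular W' f' &
       forall y s, W y -> W' y -> f' y s = f y s]) -> regular W f;
  regular_mul : forall W f g, open W -> regular W f -> regular W g ->
    regular W (fun x s => f x s * g x s);
  regular_one : forall W f, regular W f -> regular W (fun x _ => f x (fone F))
}.

Variables (M : topologicalType).

(* A bundle is a family of fibres N x with an atlas of local trivializations
   x, v |-> (x, tfun x v) onto tdom * F whose transition maps are regular; the
   manifold structure on the total space is the one induced by this atlas.
   tfun and tinv are only meaningful over tdom. *)
Record ltriv (F : fibre) (N : M -> Type) := Ltriv {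
  tdom : set M;
  tfun : forall x, N x -> F;
  tinv : forall x, F -> N x;
  tdom_open : open tdom;
  tfunK : forall x, tdom x -> cancel (tfun (x := x)) (tinv x);
  tinvK : forall x, tdom x -> cancel (tinv x) (tfun (x := x))
}.

(* (x, s) |-> t' (f (t^-1 (x, s))) is regular on the product of the common
   domain with the fibre *)
Definition regular_map (F : fibre) (O : regularity M F) (N N' : M -> Type)
    (A : set (ltriv F N)) (A' : set (ltriv F N')) (f : forall x, N x -> N' x) :=
  forall t t', A t -> A' t' ->
    O (tdom t `&` tdom t') (fun x s => fval (tfun t' (f x (tinv t x s)))).

Lemma regular_sub (F : fibre) (O : regularity M F) W W' f : open W -> open W' ->
  W `<=` W' -> O W' f -> O W f.
Proof.
move=> oW oW' WW' h; apply: regular_local => // x Wx.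
by exists W', f; split=> //; exact: WW'.
Qed.

Lemma regular_map_comp (F : fibre) (O : regularity M F) (N N' N'' : M -> Type)
    (A : set (ltriv F N)) (A' : set (ltriv F N')) (A'' : set (ltriv F N''))
    f g :
  (forall x, exists2 t, A' t & tdom t x) ->
  (forall t t' x s, A' t -> A'' t' -> tdom t x -> tdom t' x ->
     fval (tfun t' (g x (tinv t x s))) =
     fval (tfun t' (g x (tinv t x (fone F)))) * fval s) ->
  regular_map O A A' f -> regular_map O A' A'' g ->
  regular_map O A A'' (fun x v => g x (f x v)).
Proof.
move=> cov hom rf rg t t'' At At''.
apply: regular_local => [|x [tx t''x]].
  by apply: openI; exact: tdom_open.
have [t' At' t'x] := cov x.
pose W := tdom t `&` tdom t' `&` tdom t''.
have oW : open W by do 2?apply: openI; exact: tdom_open.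
exists W, (fun x s => fval (tfun t'' (g x (tinv t' x (fone F)))) *
                      fval (tfun t' (f x (tinv t x s)))); split=> //.
- apply: regular_mul => //.
    apply: regular_one (fun x s => fval (tfun t'' (g x (tinv t' x s)))) _.
    apply: regular_sub (rg _ _ At' At'') => //; last by move=> y [[]].
    by apply: openI; exact: tdom_open.
  apply: regular_sub (rf _ _ At At') => //; last by move=> y [].
  by apply: openI; exact: tdom_open.
- move=> y s _ [[ty t'y] t''y].
  by rewrite -hom // tfunK.
Qed.

End Regularity.

Section Classes.
Variables (R : realType) (M : topologicalType) (E : normedModType R).
Implicit Types (S : normedModType R).

Definition reim (z : R[i]) : R * R := (complex.Re z, complex.Im z).
Definition ofpair (p : R * R) : R[i] := (p.1 +i* p.2)%C.

Definition fibred_dom S (c : chart M E) (W : set M) : set (E * S) :=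
  [set p | crng c p.1 /\ W (cinv c p.1)].

Lemma chart_dom_open (c : chart M E) (W : set M) : open W ->
  open [set y | crng c y /\ W (cinv c y)].
Proof.
move=> oW; rewrite openE => y [cy Wy]; near=> z; split.
  by near: z; apply: open_nbhs_nbhs; split=> //; exact: crng_open.
by near: z; have := cinv_cts cy; apply; exact: open_nbhs_nbhs.
Unshelve. all: by end_near. Qed.

Lemma fibred_dom_open S (c : chart M E) (W : set M) : open W ->
  open (fibred_dom c W : set (E * S)).
Proof.
move=> oW; rewrite openE => -[y s] cWy.
exists ([set z | crng c z /\ W (cinv c z)], setT) => /=.
  split; last exact: filterT.
  by apply: open_nbhs_nbhs; split; [exact: chart_dom_open|exact: cWy].
by move=> [z s'] [].
Qed.

(* C-valued functions on W * F, read in the charts of A and in a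
   parametrization par of the fibre *)
Definition smooth_over (A : set (chart M E)) S (F : Type) (par : S -> F)
    (W : set M) (f : M -> F -> R[i]) :=
  forall c, A c -> smooth (fibred_dom c W)
    (fun p : E * S => reim (f (cinv c p.1) (par p.2))).

Definition smooth_fun (A : set (chart M E)) (W : set M) (f : M -> R[i]) :=
  forall c, A c -> smooth [set y | crng c y /\ W (cinv c y)]
    (fun y => reim (f (cinv c y))).

Lemma reimM k (V : normedModType R) (D : set V) (f g : V -> R[i]) : open D ->
  Ck k D (fun p => reim (f p)) -> Ck k D (fun p => reim (g p)) ->
  Ck k D (fun p => reim (f p * g p)).
Proof.
move=> oD /(Ck_pair _ _ oD)[f1 f2] /(Ck_pair _ _ oD)[g1 g2].
apply/(Ck_pair _ _ oD); split.
  have /Ck_congr : Ck k D ((fst \o (fun p => reim (f p))) *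
      (fst \o (fun p => reim (g p))) - (snd \o (fun p => reim (f p))) *
      (snd \o (fun p => reim (g p)))).
    by apply: CkD => //; [exact: CkM|apply: CkN => //; exact: CkM].
  by apply=> // x _; rewrite !fctE /=; case: (f x) (g x) => ? ? [].
have /Ck_congr : Ck k D ((fst \o (fun p => reim (f p))) *
      (snd \o (fun p => reim (g p))) + (snd \o (fun p => reim (f p))) *
      (fst \o (fun p => reim (g p)))).
  by apply: CkD => //; exact: CkM.
by apply=> // x _; rewrite !fctE /=; case: (f x) (g x) => ? ? [].
Qed.

Lemma smooth_over_local A S F (par : S -> F) W f : open W ->
  (forall x, W x -> exists W' f', [/\ open W', W' x, smooth_over A par W' f' &
     forall y s, W y -> W' y -> f' y s = f y s]) -> smooth_over A par W f.
Proof.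
move=> oW h c Ac k; apply: Ck_point => -[y s] [/= cy Wy].
have [W' [f' [oW' W'y hf' ff']]] := h _ Wy.
exists (fibred_dom c (W `&` W')); first by [].
apply: (Ck_congr (f := fun p => reim (f' (cinv c p.1) (par p.2)))).
- by apply: fibred_dom_open; exact: openI.
- by move=> p [_ [? ?]]; rewrite ff'.
- by apply: Ck_sub (hf' c Ac k) => p [? [_ ?]].
Qed.

Lemma smooth_over_mul A S F (par : S -> F) W f g : open W ->
  smooth_over A par W f -> smooth_over A par W g ->
  smooth_over A par W (fun x s => f x s * g x s).
Proof.
move=> oW hf hg c Ac k.
by apply: reimM; [exact: fibred_dom_open|exact: hf|exact: hg].
Qed.

Lemma smooth_over_eval A S S' F F' (par : S -> F) (par' : S' -> F') s W f :
  smooth_over A par W f -> smooth_over A par' W (fun x _ => f x (par s)).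
Proof.
move=> hf c Ac k.
have := @Ck_affine _ _ _ _ (fun p : E * S' => (p.1, s)) (fun p => (p.1, 0))
  _ _ k _ _ (hf c Ac k).
apply.
  by move=> x v h /=; congr pair; rewrite /= scaler0 add0r.
by move=> x; apply: differentiable_pair => //; exact: fst_diff.
Qed.

End Classes.

Section Instances.
Variables (R : realType) (n : nat) (M : manifold R n).

Lemma ofpair1 : ofpair ((1, 0) : R * R) = 1. Proof. by []. Qed.

Lemma cis0 : cis 0 = circle1 R.
Proof. by apply/val_inj; rewrite /= cos0 sin0. Qed.

Fact smooth_line_one W f :
  smooth_over (atlas M) (@ofpair R) W f ->
  smooth_over (atlas M) (@ofpair R) W (fun x _ => f x (fone (line_fibre R))).
Proof. by move=> h; rewrite /= -ofpair1; exact: smooth_over_eval h. Qed.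

Definition smooth_line : regularity M (line_fibre R) :=
  Regularity (F := line_fibre R)
    (@smooth_over_local _ _ _ (atlas M) _ _ (@ofpair R))
    (@smooth_over_mul _ _ _ (atlas M) _ _ (@ofpair R)) smooth_line_one.

Fact smooth_circle_one W f :
  smooth_over (atlas M) (@cis R) W f ->
  smooth_over (atlas M) (@cis R) W (fun x _ => f x (fone (circle_fibre R))).
Proof. by move=> h; rewrite /= -cis0; exact: smooth_over_eval h. Qed.

(* T is parametrized by the local diffeomorphism t |-> exp (i t) *)
Definition smooth_circle : regularity M (circle_fibre R) :=
  Regularity (F := circle_fibre R)
    (@smooth_over_local _ _ _ (atlas M) _ _ (@cis R))
    (@smooth_over_mul _ _ _ (atlas M) _ _ (@cis R)) smooth_circle_one.

Variables (m : nat) (J : complex_structure M m).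
Let E := ('rV[R]_m * 'rV[R]_m)%type.

Definition Jprod (p : E * (R * R)) : E * (R * R) := (Jpair p.1, Jpair p.2).

Definition holomorphic_over (W : set M) (f : M -> R[i] -> R[i]) :=
  forall c, catlas J c -> holomorphic Jprod (@Jpair R) (fibred_dom c W)
    (fun p : E * (R * R) => reim (f (cinv c p.1) (ofpair p.2))).

Lemma holomorphic_smooth W f :
  holomorphic_over W f -> smooth_over (catlas J) (@ofpair R) W f.
Proof. by move=> h c /h[]. Qed.

Fact holomorphic_over_local W f : open W ->
  (forall x, W x -> exists W' f', [/\ open W', W' x, holomorphic_over W' f' &
     forall y s, W y -> W' y -> f' y s = f y s]) -> holomorphic_over W f.
Proof.
move=> oW h c Jc; split.
  apply: (smooth_over_local (A := catlas J)) Jc => // x /h[W' [f' [oW' W'x hf' ff']]].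
  by exists W', f'; split=> //; exact: holomorphic_smooth.
move=> [y s] v [/= cy Wy].
have [W' [f' [oW' W'y hf' ff']]] := h _ Wy.
pose F' (p : E * (R * R)) := reim (f' (cinv c p.1) (ofpair p.2)).
have e u : 'D_u (fun p : E * (R * R) => reim (f (cinv c p.1) (ofpair p.2)))
    (y, s) = 'D_u F' (y, s).
  apply: near_eq_derive.
  have : open_nbhs (y, s) (fibred_dom c (W `&` W') : set (E * (R * R))).
    by split=> //; apply: fibred_dom_open; exact: openI.
  move=> /open_nbhs_nbhs; apply: filterS => p [_ [? ?]].
  by rewrite /F' ff'.
by rewrite !e; have [_ ->] := hf' c Jc.
Qed.

Fact holomorphic_over_mul W f g : open W ->
  holomorphic_over W f -> holomorphic_over W g ->
  holomorphic_over W (fun x s => f x s * g x s).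
Proof.
move=> oW hf hg c Jc; split.
  exact: (smooth_over_mul oW (holomorphic_smooth hf) (holomorphic_smooth hg)).
move=> x v Dx.
have [sf /(_ x v Dx) cf] := hf c Jc; have [sg /(_ x v Dx) cg] := hg c Jc.
have oD : open (fibred_dom c W : set (E * (R * R))) by exact: fibred_dom_open.
have [+ _] := smooth_over_mul oW (holomorphic_smooth hf) (holomorphic_smooth hg)
  Jc 1%N => /(_ x Dx) dfg.
have [+ _] := sf 1%N => /(_ x Dx) df.
have [+ _] := sg 1%N => /(_ x Dx) dg.
rewrite !(derive_pair _ dfg).
rewrite !(derive_pair _ df) in cf; rewrite !(derive_pair _ dg) in cg.
set F : E * (R * R) -> _ := fun p => reim (f (cinv c p.1) (ofpair p.2)).
set G : E * (R * R) -> _ := fun p => reim (g (cinv c p.1) (ofpair p.2)).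
rewrite -/F in df cf; rewrite -/G in dg cg.
set f1 := fst \o F in cf; set f2 := snd \o F in cf.
set g1 := fst \o G in cg; set g2 := snd \o G in cg.
have e1 : fst \o (fun p : E * (R * R) =>
    reim (f (cinv c p.1) (ofpair p.2) * g (cinv c p.1) (ofpair p.2))) =
    f1 * g1 - f2 * g2.
  apply/funext=> p; rewrite !fctE /f1 /f2 /g1 /g2 /F /G /=.
  by case: (f _ _) (g _ _) => ? ? [].
have e2 : snd \o (fun p : E * (R * R) =>
    reim (f (cinv c p.1) (ofpair p.2) * g (cinv c p.1) (ofpair p.2))) =
    f1 * g2 + f2 * g1.
  apply/funext=> p; rewrite !fctE /f1 /f2 /g1 /g2 /F /G /=.
  by case: (f _ _) (g _ _) => ? ? [].
rewrite e1 e2.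
have d1 u : derivable f1 x u.
  by apply: diff_derivable; apply: differentiable_comp df (@fst_diff _ _ _ _).
have d2 u : derivable f2 x u.
  by apply: diff_derivable; apply: differentiable_comp df (@snd_diff _ _ _ _).
have d3 u : derivable g1 x u.
  by apply: diff_derivable; apply: differentiable_comp dg (@fst_diff _ _ _ _).
have d4 u : derivable g2 x u.
  by apply: diff_derivable; apply: differentiable_comp dg (@snd_diff _ _ _ _).
have dM (a b : E * (R * R) -> R) u : derivable a x u -> derivable b x u ->
    derivable (a * b) x u by exact: derivableM.
rewrite !deriveB ?deriveD ?deriveM //; try exact: dM.
move: cf cg => [cf1 cf2] [cg1 cg2].
rewrite cf1 cf2 cg1 cg2 /Jpair /= /GRing.scale /=.
move: (f1 x) (f2 x) (g1 x) (g2 x) ('D_v f1 x) ('D_v f2 x) => a1 a2 b1 b2 a1' a2'.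
move: ('D_v g1 x) ('D_v g2 x) => b1' b2'.
move: {-}R a1 a2 b1 b2 a1' a2' b1' b2' => K *.
by congr pair; ring.
Qed.

Fact holomorphic_over_one W f : holomorphic_over W f ->
  holomorphic_over W (fun x _ => f x (fone (line_fibre R))).
Proof.
move=> hf c Jc; split.
  have := smooth_over_eval (S := (R * R)%type) (@ofpair R) (1, 0)
    (holomorphic_smooth hf) Jc.
  by rewrite ofpair1; apply.
move=> x v Dx; have [_ cr] := hf c Jc.
pose A (p : E * (R * R)) : E * (R * R) := (p.1, (1, 0)).
pose B (p : E * (R * R)) : E * (R * R) := (p.1, 0).
have AB y w (h : R) : A (h *: w + y) = h *: B w + A y.
  by rewrite /A /B; congr pair; rewrite /= scaler0 add0r.
have dE u : 'D_u (fun p : E * (R * R) => reim (f (cinv c p.1) 1)) x =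
    'D_(B u) (fun p : E * (R * R) => reim (f (cinv c p.1) (ofpair p.2))) (A x).
  by rewrite -(derive_affine AB).
have BJ : B (Jprod v) = Jprod (B v) by rewrite /B /Jprod /Jpair /= oppr0.
rewrite -[fone _]/1 !dE BJ.
exact: (cr (A x) (B v) Dx).
Qed.

Definition holomorphic_line : regularity M (line_fibre R) :=
  Regularity (F := line_fibre R)
    holomorphic_over_local holomorphic_over_mul holomorphic_over_one.

End Instances.

Section Bundles.
Variables (R : realType) (n : nat) (M : manifold R n).

(* T is abelian, so left and right actions agree; the action is on the right *)
Record circle_bundle := CircleBundle {
  cfam :> M -> Type;
  cact : forall x, cfam x -> circle R -> cfam x;
  cact1 : forall x (p : cfam x), cact p 1%g = p;
  cactM : forall x (p : cfam x) g h, cact p (g * h)%g = cact (cact p g) h;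
  ctriv : set (ltriv (circle_fibre R) cfam);
  ctriv_cover : forall x, exists2 t, ctriv t & tdom t x;
  ctriv_equivariant : forall t x (p : cfam x) g, ctriv t -> tdom t x ->
    tfun t (cact p g) = (tfun t p * g)%g;
  ctriv_smooth : regular_map (smooth_circle M) ctriv ctriv (fun x p => p)
}.
Arguments ctriv _ : clear implicits.

Definition circle_map_smooth (P Q : circle_bundle) (f : forall x, P x -> Q x) :=
  regular_map (smooth_circle M) (ctriv P) (ctriv Q) f.

Definition circle_iso (P Q : circle_bundle) (f : forall x, P x -> Q x) :=
  [/\ forall x (p : P x) g, f x (cact p g) = cact (f x p) g,
      circle_map_smooth f &
      exists2 f' : forall x, Q x -> P x,
        (forall x, cancel (f x) (f' x) /\ cancel (f' x) (f x)) &
        circle_map_smooth f'].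

Section Lines.
Variable O : regularity M (line_fibre R).

Record line_atlas (N : M -> lmodType R[i]) := LineAtlas {
  ltrivs :> set (ltriv (line_fibre R) N);
  ltriv_cover : forall x, exists2 t, ltrivs t & tdom t x;
  ltriv_linear : forall t x, ltrivs t -> tdom t x -> scalar (tfun t (x := x));
  ltriv_regular : regular_map O ltrivs ltrivs (fun x v => v)
}.

Record line_bundle := LineBundle {
  lfam :> M -> lmodType R[i];
  latlas : line_atlas lfam
}.

Definition line_map_regular (N L : line_bundle) (f : forall x, N x -> L x) :=
  regular_map O (latlas N) (latlas L) f.

Definition line_iso (N L : line_bundle) (f : forall x, N x -> L x) :=
  [/\ forall x, linear (f x),
      line_map_regular f &
      exists2 f' : forall x, L x -> N x,
        (forall x, cancel (f x) (f' x) /\ cancel (f' x) (f x)) &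
        line_map_regular f'].

End Lines.

(* linear in the first argument, conjugate linear in the second *)
Record hermitian_metric (N : line_bundle (smooth_line M)) := HermitianMetric {
  hform :> forall x, N x -> N x -> R[i];
  hform_linear : forall x (w : N x), scalar (fun v => hform v w);
  hform_conj : forall x (v w : N x), hform w v = (hform v w)^*%C;
  hform_pos : forall x (v : N x), v != 0 -> 0 < hform v v;
  hform_smooth : forall t (z w : R[i]), ltrivs (latlas N) t ->
    smooth_fun (atlas M) (tdom t) (fun x => hform (tinv t x z) (tinv t x w))
}.

(* A holomorphic atlas on the family of fibres of L, compatible with the smooth
   atlas of L. *)
Record holomorphic_structure (m : nat) (J : complex_structure M m)
    (L : line_bundle (smooth_line M)) := HolomorphicStructure {
  hatlas : line_atlas (holomorphic_line J) L;
  hatlas_compat : regular_map (smooth_line M) hatlas (latlas L) (fun x v => v) /\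
    regular_map (smooth_line M) (latlas L) hatlas (fun x v => v)
}.

Definition holomorphic_bundle (m : nat) (J : complex_structure M m)
    (L : line_bundle (smooth_line M)) (H : holomorphic_structure J L) :
    line_bundle (holomorphic_line J) := LineBundle (hatlas H).

End Bundles.
Arguments ctriv {R n M} _.

Section Associated.
Variables (R : realType) (n : nat) (M : manifold R n) (Q : circle_bundle M).

Lemma cact_trans x (p q : Q x) : exists g, q = cact p g.
Proof.
have [t Qt tx] := ctriv_cover Q x.
exists ((tfun t p)^-1 * tfun t q)%g.
rewrite -[LHS](tfunK tx) -[RHS](tfunK tx) ctriv_equivariant //.
by rewrite mulgA mulgV mul1g.
Qed.

Lemma cact_free x (p : Q x) g h : cact p g = cact p h -> g = h.
Proof.
have [t Qt tx] := ctriv_cover Q x.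
by move=> /(congr1 (tfun t (x := x))); rewrite !ctriv_equivariant // => /mulgI.
Qed.

Section Fibre.
Variable x : M.
Notation QC := ({classic (Q x)} * R[i])%type.

Definition assoc_rel (a b : QC) : bool :=
  `[< exists g, b = (cact (a.1 : Q x) g, (cval g)^-1 * a.2) >].

Fact assoc_rel_refl : reflexive assoc_rel.
Proof.
move=> [q z]; apply/asboolP; exists 1%g.
by rewrite /= cact1 invr1 mul1r.
Qed.

Fact assoc_rel_sym : symmetric assoc_rel.
Proof.
suff h a b : assoc_rel a b -> assoc_rel b a by move=> a b; apply/idP/idP; exact: h.
move=> /asboolP[g ->]; apply/asboolP; exists (g^-1)%g; case: a => q z /=.
by rewrite -cactM mulgV cact1 /= invrK mulVKf // cval_neq0.
Qed.

Fact assoc_rel_trans : transitive assoc_rel.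
Proof.
move=> b a c /asboolP[g ->] /asboolP[h ->]; apply/asboolP; exists (g * h)%g.
by rewrite /= cactM invfM mulrA [_^-1 * _]mulrC.
Qed.

Canonical assoc_equiv :=
  EquivRel assoc_rel assoc_rel_refl assoc_rel_sym assoc_rel_trans.

(* the fibre of Q *_T C: classes of pairs, with (q g, z) ~ (q, g z) *)
Definition assoc_fibre := {eq_quot assoc_equiv}%qT.
HB.instance Definition _ := Choice.on assoc_fibre.

Definition assoc_class (q : Q x) (z : R[i]) : assoc_fibre :=
  \pi_assoc_fibre%qT ((q : {classic (Q x)}), z).

Lemma assoc_class_act q g z :
  assoc_class (cact q g) z = assoc_class q (cval g * z).
Proof.
apply/eqmodP/asboolP; exists (g^-1)%g => /=.
by rewrite -cactM mulgV cact1 /= invrK.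
Qed.

Lemma assoc_ind (P : assoc_fibre -> Prop) :
  (forall q z, P (assoc_class q z)) -> forall v, P v.
Proof. by move=> h v; rewrite -[v]reprK; case: (repr v) => q z; exact: h. Qed.

Definition base_point : Q x := tinv (s2val (cid2 (ctriv_cover Q x))) x 1%g.

Definition translation (p q : Q x) : circle R := projT1 (cid (cact_trans p q)).

Lemma translationP p q : q = cact p (translation p q).
Proof. exact: projT2 (cid (cact_trans p q)). Qed.

Lemma translation_act p q g :
  translation p (cact q g) = (translation p q * g)%g.
Proof.
by apply: (@cact_free x p); rewrite -translationP cactM -translationP.
Qed.

Definition assoc_coord (v : assoc_fibre) : R[i] :=
  cval (translation base_point (repr v).1) * (repr v).2.

Lemma assoc_coordE q z :
  assoc_coord (assoc_class q z) = cval (translation base_point q) * z.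
Proof.
rewrite /assoc_coord.
have /eqmodP/asboolP[g ->] : assoc_class q z = \pi_assoc_fibre%qT (repr (assoc_class q z)).
  by rewrite reprK.
by rewrite /= translation_act cvalM -mulrA mulVKf // cval_neq0.
Qed.

Lemma assoc_coordK : cancel assoc_coord (assoc_class base_point).
Proof.
elim/assoc_ind => q z; rewrite assoc_coordE -assoc_class_act.
by rewrite -translationP.
Qed.

Lemma assoc_classK : cancel (assoc_class base_point) assoc_coord.
Proof.
move=> z; rewrite assoc_coordE.
have -> : translation base_point base_point = 1%g.
  by apply: (@cact_free x base_point); rewrite -translationP cact1.
by rewrite mul1r.
Qed.

Definition assoc_zero := assoc_class base_point 0.
Definition assoc_opp v := assoc_class base_point (- assoc_coord v).
Definition assoc_add v w := assoc_class base_point (assoc_coord v + assoc_coord w).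
Definition assoc_scale a v := assoc_class base_point (a * assoc_coord v).

Fact assoc_addA : associative assoc_add.
Proof. by move=> u v w; rewrite /assoc_add !assoc_classK addrA. Qed.
Fact assoc_addC : commutative assoc_add.
Proof. by move=> u v; rewrite /assoc_add addrC. Qed.
Fact assoc_add0 : left_id assoc_zero assoc_add.
Proof. by move=> u; rewrite /assoc_add assoc_classK add0r assoc_coordK. Qed.
Fact assoc_addN : left_inverse assoc_zero assoc_opp assoc_add.
Proof. by move=> u; rewrite /assoc_add assoc_classK addNr. Qed.

HB.instance Definition _ := GRing.isZmodule.Build assoc_fibre
  assoc_addA assoc_addC assoc_add0 assoc_addN.

Fact assoc_scaleA a b v :
  assoc_scale a (assoc_scale b v) = assoc_scale (a * b) v.
Proof. by rewrite /assoc_scale assoc_classK mulrA. Qed.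
Fact assoc_scale1 : left_id 1 assoc_scale.
Proof. by move=> v; rewrite /assoc_scale mul1r assoc_coordK. Qed.
Fact assoc_scaleDr : right_distributive assoc_scale +%R.
Proof.
by move=> a u v; rewrite /assoc_scale /GRing.add /= /assoc_add !assoc_classK mulrDr.
Qed.
Fact assoc_scaleDl v : {morph assoc_scale^~ v : a b / a + b}.
Proof.
by move=> a b; rewrite /assoc_scale /GRing.add /= /assoc_add !assoc_classK -mulrDl.
Qed.

HB.instance Definition _ := GRing.Zmodule_isLmodule.Build R[i] assoc_fibre
  assoc_scaleA assoc_scale1 assoc_scaleDr assoc_scaleDl.

Lemma assoc_classD q z w :
  assoc_class q (z + w) = assoc_class q z + assoc_class q w.
Proof.
apply: (can_inj assoc_coordK).
by rewrite [RHS]assoc_classK !assoc_coordE mulrDr.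
Qed.

Lemma assoc_classZ q a z : assoc_class q (a * z) = a *: assoc_class q z.
Proof.
apply: (can_inj assoc_coordK).
by rewrite [RHS]assoc_classK !assoc_coordE mulrCA.
Qed.

End Fibre.
End Associated.

Section AssociatedLine.
Variables (R : realType) (n : nat) (M : manifold R n) (Q : circle_bundle M).
Local Notation L := (@assoc_fibre R n M Q).

Lemma smooth_line_id (W : set M) : smooth_line M W (fun _ z => z).
Proof.
move=> c _ k.
have sE (f : 'rV[R]_n * (R * R) -> R * R) :
    f =1 snd -> Ck k (fibred_dom c W) f.
  move=> /funext ->; case: k => [|k] /=.
    move=> x _; apply: differentiable_continuous; exact: snd_diff.
  split=> [x _|v]; first exact: snd_diff.
  have -> : 'D_v (snd : 'rV[R]_n * (R * R) -> R * R) = cst v.2.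
    apply/funext=> x.
    have /= -> := @derive_affine _ _ _ _ (snd : 'rV[R]_n * (R * R) -> R * R)
      snd _ id x v; last by [].
    exact: derive_id.
  exact: Ck_cst.
by apply: sE => -[y [a b]].
Qed.

Section Triv.
Variables (t : ltriv (circle_fibre R) Q) (Qt : ctriv Q t).

Definition assoc_tfun x (v : L x) : R[i] :=
  cval (tfun t ((repr v).1 : Q x)) * (repr v).2.
Definition assoc_tinv x (z : R[i]) : L x := assoc_class (tinv t x 1%g) z.

Lemma assoc_tfunE x (q : Q x) z : tdom t x ->
  assoc_tfun (assoc_class q z) = cval (tfun t q) * z.
Proof.
move=> tx; rewrite /assoc_tfun.
have /eqmodP/asboolP[g ->] :
    assoc_class q z = \pi_(L x)%qT (repr (assoc_class q z)) by rewrite reprK.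
by rewrite /= ctriv_equivariant // cvalM -mulrA mulVKf // cval_neq0.
Qed.

Fact assoc_tfunK x : tdom t x -> cancel (@assoc_tfun x) (assoc_tinv x).
Proof.
move=> tx; elim/assoc_ind => q z.
rewrite assoc_tfunE // /assoc_tinv -assoc_class_act.
congr assoc_class; rewrite -[RHS](tfunK tx) -[LHS](tfunK tx).
by rewrite ctriv_equivariant // tinvK // mul1g.
Qed.

Fact assoc_tinvK x : tdom t x -> cancel (assoc_tinv x) (@assoc_tfun x).
Proof. by move=> tx z; rewrite assoc_tfunE // tinvK // mul1r. Qed.

Definition assoc_triv : ltriv (line_fibre R) L :=
  Ltriv (F := line_fibre R) (@tdom_open _ _ _ _ t) assoc_tfunK assoc_tinvK.

End Triv.

Definition assoc_ltrivs : set (ltriv (line_fibre R) L) :=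
  [set s | exists t (Qt : ctriv Q t), s = assoc_triv Qt].

Fact assoc_cover x : exists2 s, assoc_ltrivs s & tdom s x.
Proof.
by have [t Qt tx] := ctriv_cover Q x; exists (assoc_triv Qt) => //; exists t, Qt.
Qed.

Fact assoc_linear s x : assoc_ltrivs s -> tdom s x -> scalar (tfun s (x := x)).
Proof.
move=> [t [Qt ->]] /= tx a u v; apply: (can_inj (assoc_tinvK Qt tx)).
rewrite assoc_tfunK // /assoc_tinv assoc_classD assoc_classZ.
by rewrite -![assoc_class _ _]/(assoc_tinv t x _) !assoc_tfunK.
Qed.

Fact assoc_smooth :
  regular_map (smooth_line M) assoc_ltrivs assoc_ltrivs (fun x v => v).
Proof.
move=> _ _ [t [Qt ->]] [t' [Qt' ->]] /=.
have oW : open (tdom t `&` tdom t') by apply: openI; exact: tdom_open.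
apply: (regular_local (r := smooth_line M)) => // x Wx.
exists (tdom t `&` tdom t'),
  (fun x z => cval (tfun t' (tinv t x (cis 0))) * z); split=> //.
  apply: (regular_mul (r := smooth_line M)) => //; last exact: smooth_line_id.
  exact: (smooth_over_eval (@ofpair R) 0 (ctriv_smooth Qt Qt')).
by move=> y z [_ ty'] _; rewrite assoc_tfunE // cis0.
Qed.

(* Q *_{SO(2)} R^2, with R^2 = C *)
Definition assoc_line_bundle : line_bundle (smooth_line M) :=
  @LineBundle R n M (smooth_line M) (fun x => L x)
    (@LineAtlas R n M (smooth_line M) (fun x => L x) assoc_ltrivs
      assoc_cover assoc_linear assoc_smooth).

Definition assoc_form x (v w : L x) : R[i] :=
  assoc_coord v * (assoc_coord w)^*%C.

Lemma circle_conj (g : circle R) : cval g * (cval g)^*%C = 1.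
Proof. by rewrite -sqr_normc (eqP (circleP g)) expr1n. Qed.

Lemma assoc_formE x (q : Q x) z w :
  assoc_form (assoc_class q z) (assoc_class q w) = z * w^*%C.
Proof.
by rewrite /assoc_form !assoc_coordE rmorphM /= mulrACA circle_conj mul1r.
Qed.

Lemma assoc_coord_linear x : scalar (@assoc_coord R n M Q x).
Proof.
move=> a u v; apply: (can_inj (@assoc_classK _ _ _ Q x)).
by rewrite assoc_coordK assoc_classD assoc_classZ !assoc_coordK.
Qed.

Fact assoc_form_linear x (w : L x) : scalar (fun v => assoc_form v w).
Proof.
by move=> a u v; rewrite /assoc_form assoc_coord_linear mulrDl -mulrA.
Qed.

Fact assoc_form_conj x (v w : L x) : assoc_form w v = (assoc_form v w)^*%C.
Proof. by rewrite /assoc_form [RHS]rmorphM /= conjcK mulrC. Qed.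

Fact assoc_form_pos x (v : L x) : v != 0 -> 0 < assoc_form v v.
Proof.
move=> v0; rewrite /assoc_form -sqr_normc exprn_gt0 // normr_gt0.
apply: contra_neq v0 => v0; apply: (can_inj (@assoc_coordK _ _ _ Q x)).
by rewrite v0 [RHS]assoc_classK.
Qed.

Fact assoc_form_smooth s (z w : R[i]) : assoc_ltrivs s ->
  smooth_fun (atlas M) (tdom s)
    (fun x => assoc_form (tinv s x z) (tinv s x w)).
Proof.
move=> [t [Qt ->]] c Mc k /=.
apply: (Ck_congr (f := cst (reim (z * w^*%C)))).
- by apply: chart_dom_open; exact: tdom_open.
- by move=> y _; rewrite assoc_formE.
- exact: Ck_cst.
Qed.

Definition assoc_metric : hermitian_metric assoc_line_bundle :=
  @HermitianMetric R n M assoc_line_bundle assoc_form assoc_form_linear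
    assoc_form_conj assoc_form_pos assoc_form_smooth.

End AssociatedLine.

Record category := Category {
  object :> Type;
  hom : object -> object -> Type;
  idhom : forall a, hom a a;
  comphom : forall a b c, hom a b -> hom b c -> hom a c;
  comp1hom : forall a b (f : hom a b), comphom (idhom a) f = f;
  comphom1 : forall a b (f : hom a b), comphom f (idhom b) = f;
  comphomA : forall a b c d (f : hom a b) (g : hom b c) (h : hom c d),
    comphom f (comphom g h) = comphom (comphom f g) h
}.

Record functor (C D : category) := Functor {
  fobj :> C -> D;
  fhom : forall a b : C, hom a b -> hom (fobj a) (fobj b);
  fhom_id : forall a, fhom (idhom a) = idhom (fobj a);
  fhom_comp : forall a b c (f : hom a b) (g : hom b c),
    fhom (comphom f g) = comphom (fhom f) (fhom g)
}.

Definition functor_id (C : category) : functor C C :=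
  @Functor C C id (fun a b f => f) (fun _ => erefl) (fun _ _ _ _ _ => erefl).

Section FunctorComp.
Variables (C D E : category) (F : functor C D) (G : functor D E).

Fact functor_comp_id a : fhom G (fhom F (idhom a)) = idhom (G (F a)).
Proof. by rewrite !fhom_id. Qed.
Fact functor_comp_comp a b c (f : hom a b) (g : hom b c) :
  fhom G (fhom F (comphom f g)) = comphom (fhom G (fhom F f)) (fhom G (fhom F g)).
Proof. by rewrite !fhom_comp. Qed.

Definition functor_comp : functor C E :=
  @Functor C E (fun a => G (F a)) (fun a b f => fhom G (fhom F f))
    functor_comp_id functor_comp_comp.
End FunctorComp.

Definition naturally_isomorphic (C D : category) (F G : functor C D) : Prop :=
  exists (u : forall a, hom (F a) (G a)) (v : forall a, hom (G a) (F a)),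
    (forall a, comphom (u a) (v a) = idhom (F a) /\
               comphom (v a) (u a) = idhom (G a)) /\
    (forall a b (f : hom a b), comphom (u a) (fhom G f) = comphom (fhom F f) (u b)).

Definition equivalent (C D : category) : Prop :=
  exists (F : functor C D) (G : functor D C),
    naturally_isomorphic (functor_comp F G) (functor_id C) /\
    naturally_isomorphic (functor_comp G F) (functor_id D).

Section SpinCategory.
Variables (R : realType) (n : nat) (M : manifold R n) (Q : circle_bundle M).

(* Spin_2 and SO(2) are both T, and the covering Spin_2 -> SO(2) is squaring *)
Record spin_structure := SpinStructure {
  spin_bundle :> circle_bundle M;
  spin_map : forall x, spin_bundle x -> Q x;
  spin_smooth : circle_map_smooth spin_map;
  spin_equivariant : forall x (p : spin_bundle x) g,
    spin_map (cact p g) = cact (spin_map p) (g ^+ 2)%g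
}.

Definition spin_hom (P P' : spin_structure) :=
  {f : forall x, P x -> P' x |
    circle_iso f /\ forall x (p : P x), spin_map (f x p) = spin_map p}.

Lemma circle_iso_id (P : circle_bundle M) : circle_iso (fun x (p : P x) => p).
Proof.
split=> //; first exact: ctriv_smooth.
by exists (fun x p => p) => //; exact: ctriv_smooth.
Qed.

Lemma circle_map_comp (P P' P'' : circle_bundle M)
    (f : forall x, P x -> P' x) (g : forall x, P' x -> P'' x) :
  (forall x (p : P' x) h, g x (cact p h) = cact (g x p) h) ->
  circle_map_smooth f -> circle_map_smooth g ->
  circle_map_smooth (fun x p => g x (f x p)).
Proof.
move=> eg; apply: regular_map_comp; first exact: ctriv_cover.
move=> t t' x s Pt Pt' tx t'x.
have -> : tinv t x s = cact (tinv t x 1%g) s.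
  rewrite -[LHS](tfunK tx) -[RHS](tfunK tx) ctriv_equivariant // !tinvK //.
  by rewrite mul1g.
by rewrite eg ctriv_equivariant.
Qed.

Lemma circle_iso_comp (P P' P'' : circle_bundle M)
    (f : forall x, P x -> P' x) (g : forall x, P' x -> P'' x) :
  circle_iso f -> circle_iso g -> circle_iso (fun x p => g x (f x p)).
Proof.
move=> [ef sf [f' ff' sf']] [eg sg [g' gg' sg']]; split.
- by move=> x p h; rewrite ef eg.
- exact: circle_map_comp.
- exists (fun x p => f' x (g' x p)) => [x|].
    by split=> p; rewrite ?(gg' x).1 ?(ff' x).1 ?(ff' x).2 ?(gg' x).2.
  apply: circle_map_comp => // x p h.
  by apply: (can_inj (ff' x).1); rewrite ef !(ff' x).2.
Qed.

Definition spin_id (P : spin_structure) : spin_hom P P :=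
  exist _ (fun x p => p) (conj (circle_iso_id P) (fun x p => erefl)).

Fact spin_comp_subproof (P P' P'' : spin_structure)
    (f : spin_hom P P') (g : spin_hom P' P'') :
  circle_iso (fun x p => sval g x (sval f x p)) /\
  forall x (p : P x), spin_map (sval g x (sval f x p)) = spin_map p.
Proof.
case: f g => [f [f1 f2]] [g [g1 g2]] /=; split; first exact: circle_iso_comp.
by move=> x p; rewrite g2 f2.
Qed.

Definition spin_comp (P P' P'' : spin_structure) (f : spin_hom P P')
    (g : spin_hom P' P'') : spin_hom P P'' :=
  exist _ (fun x p => sval g x (sval f x p)) (spin_comp_subproof f g).

Fact spin_comp1 P P' (f : spin_hom P P') : spin_comp (spin_id P) f = f.
Proof. by case: f => f hf; exact: eq_exist. Qed.
Fact spin_comp_1 P P' (f : spin_hom P P') : spin_comp f (spin_id P') = f.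
Proof. by case: f => f hf; exact: eq_exist. Qed.
Fact spin_compA P0 P1 P2 P3 (f : spin_hom P0 P1) (g : spin_hom P1 P2)
    (h : spin_hom P2 P3) :
  spin_comp f (spin_comp g h) = spin_comp (spin_comp f g) h.
Proof. exact: eq_exist. Qed.

(* Prin(M, Spin_2) / Q *)
Definition spin_category : category :=
  Category spin_comp1 spin_comp_1 spin_compA.

End SpinCategory.

(* the polarization is symmetric, so linearity in one argument is bilinearity *)
Definition quadratic_map (K : nzRingType) (V W : lmodType K) (q : V -> W) :=
  (forall a v, q (a *: v) = a ^+ 2 *: q v) /\
  (forall u, linear (fun v => q (u + v) - q u - q v)).

Section SquareRoots.
Variables (R : realType) (n : nat) (M : manifold R n).
Variables (O : regularity M (line_fibre R)) (L : line_bundle O).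

Record square_root := SquareRoot {
  sqrt_bundle :> line_bundle O;
  sqrt_map : forall x, sqrt_bundle x -> L x;
  sqrt_regular : line_map_regular sqrt_map;
  sqrt_surjective : forall x (w : L x), exists v, sqrt_map v = w;
  sqrt_quadratic : forall x, quadratic_map (sqrt_map (x := x))
}.

Definition sqrt_hom (N N' : square_root) :=
  {f : forall x, N x -> N' x |
    line_iso f /\ forall x (v : N x), sqrt_map (f x v) = sqrt_map v}.

Lemma line_iso_id (N : line_bundle O) : line_iso (fun x (v : N x) => v).
Proof.
split=> //; first exact: ltriv_regular.
by exists (fun x v => v) => //; exact: ltriv_regular.
Qed.

Lemma line_map_comp (N N' N'' : line_bundle O)
    (f : forall x, N x -> N' x) (g : forall x, N' x -> N'' x) :
  (forall x, linear (g x)) -> line_map_regular f -> line_map_regular g ->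
  line_map_regular (fun x v => g x (f x v)).
Proof.
move=> lg; apply: regular_map_comp; first exact: ltriv_cover.
move=> t t' x s Nt Nt' tx t'x.
have sc (N0 : line_bundle O) (t0 : ltriv (line_fibre R) (fun y => N0 y)) :
    ltrivs (latlas N0) t0 -> tdom t0 x ->
    forall a v, tfun t0 (a *: v) = (a : R[i]) * tfun t0 (v : N0 x).
  move=> h0 d0 a v; have l0 := ltriv_linear h0 d0.
  have z0 : tfun t0 (0 : N0 x) = 0 :> R[i].
    have := l0 0 0 0; rewrite scaler0 addr0 mul0r add0r.
    by have := l0 (-1) 0 0; rewrite scaler0 addr0 mulN1r addNr.
  by have := l0 a v 0; rewrite addr0 z0 addr0.
have -> : tinv t x s = (s : R[i]) *: (tinv t x (1 : R[i]) : N' x).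
  rewrite -[LHS](tfunK tx) -[RHS](tfunK tx) sc // !tinvK //.
  by rewrite mulr1.
have -> a v : g x (a *: v) = a *: g x v.
  have z0 : g x 0 = 0.
    by have := lg x (-1) 0 0; rewrite scaler0 addr0 scaleN1r addNr.
  by have := lg x a v 0; rewrite addr0 z0 addr0.
by rewrite sc // mulrC.
Qed.

Lemma line_iso_comp (N N' N'' : line_bundle O)
    (f : forall x, N x -> N' x) (g : forall x, N' x -> N'' x) :
  line_iso f -> line_iso g -> line_iso (fun x v => g x (f x v)).
Proof.
move=> [lf sf [f' ff' sf']] [lg sg [g' gg' sg']]; split.
- by move=> x a u v; rewrite lf lg.
- exact: line_map_comp.
- exists (fun x v => f' x (g' x v)) => [x|].
    by split=> v; rewrite ?(gg' x).1 ?(ff' x).1 ?(ff' x).2 ?(gg' x).2.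
  apply: line_map_comp => // x a u v.
  by apply: (can_inj (ff' x).1); rewrite lf !(ff' x).2.
Qed.

Definition sqrt_id (N : square_root) : sqrt_hom N N :=
  exist _ (fun x v => v) (conj (line_iso_id N) (fun x v => erefl)).

Fact sqrt_comp_subproof (N N' N'' : square_root)
    (f : sqrt_hom N N') (g : sqrt_hom N' N'') :
  line_iso (fun x v => sval g x (sval f x v)) /\
  forall x (v : N x), sqrt_map (sval g x (sval f x v)) = sqrt_map v.
Proof.
case: f g => [f [f1 f2]] [g [g1 g2]] /=; split; first exact: line_iso_comp.
by move=> x v; rewrite g2 f2.
Qed.

Definition sqrt_comp (N N' N'' : square_root) (f : sqrt_hom N N')
    (g : sqrt_hom N' N'') : sqrt_hom N N'' :=
  exist _ (fun x v => sval g x (sval f x v)) (sqrt_comp_subproof f g).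

Fact sqrt_comp1 N N' (f : sqrt_hom N N') : sqrt_comp (sqrt_id N) f = f.
Proof. by case: f => f hf; exact: eq_exist. Qed.
Fact sqrt_comp_1 N N' (f : sqrt_hom N N') : sqrt_comp f (sqrt_id N') = f.
Proof. by case: f => f hf; exact: eq_exist. Qed.
Fact sqrt_compA N0 N1 N2 N3 (f : sqrt_hom N0 N1) (g : sqrt_hom N1 N2)
    (h : sqrt_hom N2 N3) :
  sqrt_comp f (sqrt_comp g h) = sqrt_comp (sqrt_comp f g) h.
Proof. exact: eq_exist. Qed.

(* smooth or holomorphic square roots of L, according to O *)
Definition sqrt_category : category :=
  Category sqrt_comp1 sqrt_comp_1 sqrt_compA.

End SquareRoots.

Section HermitianSquareRoots.
Variables (R : realType) (n : nat) (M : manifold R n).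
Variables (L : line_bundle (smooth_line M)) (h : hermitian_metric L).

Record hermitian_root := HermitianRoot {
  herm_root :> square_root L;
  herm_metric : hermitian_metric herm_root;
  herm_unit : forall x (v : herm_root x),
    herm_metric x v v = 1 -> h x (sqrt_map v) (sqrt_map v) = 1
}.

Definition unitary (N N' : hermitian_root) (f : forall x, N x -> N' x) :=
  forall x (v w : N x), herm_metric N' x (f x v) (f x w) = herm_metric N x v w.

Definition herm_hom (N N' : hermitian_root) :=
  {f : sqrt_hom N N' | @unitary N N' (sval f)}.

Definition herm_id (N : hermitian_root) : herm_hom N N :=
  exist _ (sqrt_id N) (fun x v w => erefl).

Fact herm_comp_subproof (N N' N'' : hermitian_root)
    (f : herm_hom N N') (g : herm_hom N' N'') :
  @unitary N N'' (sval (sqrt_comp (sval f) (sval g))).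
Proof. by case: f g => [f hf] [g hg] x v w /=; rewrite hg hf. Qed.

Definition herm_comp (N N' N'' : hermitian_root) (f : herm_hom N N')
    (g : herm_hom N' N'') : herm_hom N N'' :=
  exist _ (sqrt_comp (sval f) (sval g)) (herm_comp_subproof f g).

Fact herm_comp1 N N' (f : herm_hom N N') : herm_comp (herm_id N) f = f.
Proof. by case: f => f hf; apply: eq_exist; exact: sqrt_comp1. Qed.
Fact herm_comp_1 N N' (f : herm_hom N N') : herm_comp f (herm_id N') = f.
Proof. by case: f => f hf; apply: eq_exist; exact: sqrt_comp_1. Qed.
Fact herm_compA N0 N1 N2 N3 (f : herm_hom N0 N1) (g : herm_hom N1 N2)
    (k : herm_hom N2 N3) :
  herm_comp f (herm_comp g k) = herm_comp (herm_comp f g) k.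
Proof. by apply: eq_exist; exact: sqrt_compA. Qed.

Definition hermitian_sqrt_category : category :=
  Category herm_comp1 herm_comp_1 herm_compA.

End HermitianSquareRoots.

(* Main.v *)
From HB Require Import structures.
Require Import Defs.
From mathcomp Require Import all_boot all_order all_algebra.
From mathcomp Require Import all_classical all_reals all_analysis.
From mathcomp Require Import ring complex.
Set Implicit Arguments.
Unset Strict Implicit.
Unset Printing Implicit Defensive.
Import Order.TTheory GRing.Theory Num.Theory numFieldNormedType.Exports.
Local Open Scope classical_set_scope.
Local Open Scope ring_scope.

(** Every category maps to the category of smooth square roots of L by a fully
faithful, essentially surjective functor. A square root N -> L reads
z |-> c z^2 in local frames, with c a nowhere vanishing function.
- Forgetting the metric: the metric of a Hermitian root satisfies
  |v|^4 = |q v|^2, so it is determined by q, any isomorphism of roots is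
  unitary, and conversely |q v| defines a metric on a smooth root.
- A spin structure P goes to P x_T C with [p, z] |-> [phi p, z^2]; it is
  recovered as the bundle of unit vectors of the root, a unit vector v going to
  the point p of Q with q v = [p, 1].
- Forgetting the holomorphic structure: an isomorphism of roots reads z |-> a z
  with a smooth and c = a^2 c', so a is holomorphic when c and c' are.
  Conversely, the frames of a smooth root that q maps to holomorphic sections of
  L form a holomorphic atlas; rescaling a frame e by 1/sqrt c locally makes q e
  a given holomorphic frame. *)

(** * Smooth functions *)

(** Smooth roots are the natural hub: a morphism there has neither a metric nor a holomorphic
    structure to respect. Surjectivity of the square map is what makes c vanish nowhere. On a line,
    a map that is homogeneous of positive degree is known from its value on a frame, so every
    regularity question on a total space becomes one about a function on the base. The operations
    available there differ: smooth functions can be conjugated and inverted off their zeros, and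
    positive ones have smooth roots, whereas a general [regularity] offers little more than
    products. The holomorphic case therefore takes no holomorphic roots or inverses: each factor is
    first produced smoothly, and its holomorphy is read off afterwards from c = a^2 c'. A root of c
    exists only locally and up to sign, so the new holomorphic atlas contains all admissible local
    rescalings and makes no choice among them. Likewise no inverse functor is written down: only
    preimages of objects and of morphisms are constructed. *)

Section FiniteBasis.
Variable R : realType.

(** Finite dimension in the form that the chain rule consumes: fixed directions [e i], along which a
    moving vector is expanded with continuous coordinates [l i]. *)
Definition finite_basis (V : normedModType R) :=
  exists (I : finType) (e : I -> V) (l : I -> {linear V -> R}),
    (forall i, continuous (l i)) /\ forall v, v = \sum_i l i v *: e i.

Lemma finite_basis_rV n : finite_basis 'rV[R]_n.
Proof.
have l i : linear (fun v : 'rV[R]_n => v ord0 i) by move=> a u v; rewrite !mxE.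
pose L i : {linear 'rV[R]_n -> R} :=
  HB.pack (fun v : 'rV[R]_n => v ord0 i) (GRing.isLinear.Build _ _ _ _ _ (l i)).
exists 'I_n, (delta_mx ord0), L; split=> [i|v]; first exact: coord_continuous.
exact: row_sum_delta.
Qed.

Lemma finite_basis_R : finite_basis R.
Proof.
exists 'I_1, (fun _ => 1), (fun _ => idfun); split=> [i|v]; first by move=> x.
by rewrite big_ord1 /= /GRing.scale /= mulr1.
Qed.

Lemma finite_basis_prod (V W : normedModType R) :
  finite_basis V -> finite_basis W -> finite_basis (V * W)%type.
Proof.
move=> [I [e [l [cl E]]]] [I' [e' [l' [cl' E']]]].
pose b (i : I + I') : V * W :=
  match i with inl j => (e j, 0) | inr j => (0, e' j) end.
pose f (i : I + I') (p : V * W) : R :=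
  match i with inl j => l j p.1 | inr j => l' j p.2 end.
have lf i : linear (f i) by move=> a u v; case: i => j; rewrite /= linearP.
pose L i : {linear (V * W)%type -> R} :=
  HB.pack (f i) (GRing.isLinear.Build _ _ _ _ _ (lf i)).
exists (I + I')%type, b, L; split=> [[] j p|[v w]].
- by apply: (@continuous_comp _ _ _ fst (l j)); [exact: cvg_fst|exact: cl].
- by apply: (@continuous_comp _ _ _ snd (l' j)); [exact: cvg_snd|exact: cl'].
rewrite big_sumType /=.
have -> : \sum_i l i v *: ((e i, 0) : V * W) = (v, 0).
  have /= -> : \sum_i l i v *: ((e i, 0) : V * W) =
      \sum_i (l i v *: e i, 0) :> V * W.
    by apply: eq_bigr => i _; congr pair; rewrite /= scaler0.
  rewrite {2}(E v); symmetry.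
  apply: (big_morph (fun u : V => (u, 0) : V * W)) => // x y.
  by congr pair; rewrite /= addr0.
have -> : \sum_i l' i w *: ((0, e' i) : V * W) = (0, w).
  have /= -> : \sum_i l' i w *: ((0, e' i) : V * W) =
      \sum_i (0, l' i w *: e' i) :> V * W.
    by apply: eq_bigr => i _; congr pair; rewrite /= scaler0.
  rewrite {2}(E' w); symmetry.
  apply: (big_morph (fun u : W => (0, u) : V * W)) => // x y.
  by congr pair; rewrite /= addr0.
by congr pair; rewrite /= ?addr0 ?add0r.
Qed.

End FiniteBasis.

(** * The chain rule for iterated directional derivatives *)

Section CkComp.
Variables (R : realType) (V : normedModType R).

Lemma Ck_linear (W W' : normedModType R) (l : {linear W -> W'}) k (D : set V) f :
  continuous l -> open D -> Ck k D f -> Ck k D (l \o f).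
Proof.
move=> cl oD; elim: k f => [|k IH] f /=.
  by move=> hf x Dx; apply: continuous_comp; [exact: hf|exact: cl].
have dl y : differentiable l y by exact: linear_differentiable.
move=> [f1 f2]; split=> [x Dx|v].
  by apply: differentiable_comp; [exact: f1|exact: dl].
apply: Ck_congr (IH _ (f2 v)) => // x Dx /=.
have df := f1 x Dx.
rewrite !deriveE //; last exact: differentiable_comp.
rewrite (diff_comp df (dl (f x))) /=; congr (_ _).
by rewrite diff_lin.
Qed.

Lemma Ck_sum k (D : set V) (I : finType) (f : I -> V -> R) : open D ->
  (forall i, Ck k D (f i)) -> Ck k D (\sum_i f i).
Proof.
move=> oD h; elim/big_ind: _ => // [|g g'].
  exact: (Ck_cst k D (0 : R)).
exact: CkD.
Qed.

(** [Ck] differentiates along fixed vectors, whereas the chain rule applies dg in the direction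
    ['D_v f x], which moves with x. Expanding this direction in the basis gives a finite sum of
    products with the fixed derivatives ['D_(e i) g], to which the induction applies. *)
Lemma Ck_comp_scalar (W : normedModType R) k (D : set V) (D' : set W)
    (f : V -> W) (g : W -> R) : finite_basis W -> open D -> open D' ->
  (forall x, D x -> D' (f x)) ->
  Ck k D f -> Ck k D' g -> Ck k D (g \o f).
Proof.
move=> [I [e [l [cl E]]]] oD oD' DD'; elim: k f g DD' => [|k IH] f g DD'.
  move=> hf hg x Dx; apply: continuous_comp; first exact: hf.
  by apply: hg; exact: DD'.
move=> Hf Hg; have [f1 f2] := Hf; have [g1 g2] := Hg; split=> [x Dx|v].
  by apply: differentiable_comp; [exact: f1|apply: g1; exact: DD'].
apply: (Ck_congr (f := \sum_i ((l i \o 'D_v f) * ('D_(e i) g \o f)))) => //.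
  move=> x Dx; have df := f1 x Dx; have dg := g1 _ (DD' x Dx).
  have -> : 'D_v (g \o f) x = 'd g (f x) ('D_v f x).
    rewrite !deriveE //; last exact: differentiable_comp.
    by rewrite (diff_comp df dg).
  rewrite fct_sumE [in RHS](E ('D_v f x)) linear_sum.
  by apply: eq_bigr => i _; rewrite linearZ -deriveE.
apply: Ck_sum => // i; apply: CkM => //.
  exact: Ck_linear (cl i) oD (f2 v).
by apply: IH => //; [exact: CkS|exact: g2].
Qed.

End CkComp.

(** * Inverse, square root, cosine and sine *)

Section CkFunctions.
Variable R : realType.

Lemma derive_scale1 (f : R -> R) (x v : R) : differentiable f x ->
  'D_v f x = v * 'D_1 f x.
Proof. by move=> df; rewrite !deriveE // -{1}[v]mulr1 [LHS]linearZ. Qed.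

(** The bootstrap for the functions below: their derivatives are expressed by the functions
    themselves, so class C^k yields class C^(k+1). *)
Lemma Ck_derive1 k (D : set R) (f g : R -> R) : open D ->
  (forall x, D x -> is_derive x 1 f (g x)) -> Ck k D g -> Ck k.+1 D f.
Proof.
move=> oD fg gk; split=> [x /fg [df _]|v].
  by apply/derivable1_diffP.
apply: (Ck_congr (f := cst v * g)) => //; last by apply: CkM => //; exact: Ck_cst.
move=> x /fg [df E]; rewrite derive_scale1; last by apply/derivable1_diffP.
by rewrite -derive1E derive1E E.
Qed.

Lemma Ck_inv k : Ck k [set x : R | x != 0] (fun x : R => x^-1).
Proof.
have oD : open [set x : R | x != 0].
  exact: (@open_neq R 0 : open _).
elim: k => [|k IH]; first by move=> x x0; exact: inv_continuous.
apply: (Ck_derive1 (g := - ((fun x => x^-1) * (fun x => x^-1)))) => //.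
  move=> x x0.
  have := @is_deriveV R id x 1 1 x0 _; rewrite /=.
  move=> h; apply: is_derive_eq (h _) _.
  by rewrite /GRing.scale /= mulr1 !fctE /= expr2 invfM.
by apply: CkN => //; exact: CkM.
Qed.

Lemma Ck_sqrt k : Ck k [set x : R | 0 < x] Num.sqrt.
Proof.
have oD : open [set x : R | 0 < x] by exact: open_gt.
elim: k => [|k IH]; first by move=> x _; exact: sqrt_continuous.
apply: (Ck_derive1 (g := (fun x => x^-1) \o (cst 2 * Num.sqrt))) => //.
apply: (Ck_comp_scalar (D' := [set x : R | x != 0])).
- exact: finite_basis_R.
- exact: oD.
- exact: (@open_neq R 0 : open _).
- by move=> x x0; rewrite /= mulf_neq0 // gt_eqF // sqrtr_gt0.
- by apply: CkM => //; exact: Ck_cst.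
- exact: Ck_inv.
Qed.

(** One joint induction, since each is the derivative of the other up to sign. *)
Lemma Ck_cos_sin k : Ck k setT (@cos R) /\ Ck k setT (@sin R).
Proof.
elim: k => [|k [IHc IHs]].
  by split=> x _; [exact: continuous_cos|exact: continuous_sin].
split.
  apply: (Ck_derive1 (g := - @sin R)); first exact: openT.
  exact: CkN openT IHs.
apply: (Ck_derive1 (g := @cos R)); [exact: openT|exact: IHc].
Qed.

End CkFunctions.


Section LinearCk.
Variables (R : realType) (V W : normedModType R).

Lemma Ck_linear_map (l : {linear V -> W}) k (D : set V) : continuous l -> Ck k D l.
Proof.
move=> cl; case: k => [|k] /=; first by move=> x _; exact: cl.
have dl x : differentiable l x by exact: linear_differentiable.
split=> [x _|v]; first exact: dl.
have -> : 'D_v l = cst (l v).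
  by apply/funext => x; rewrite deriveE // diff_lin.
exact: Ck_cst.
Qed.

End LinearCk.

Lemma Ck_snd (R : realType) (V W : normedModType R) k (D : set (V * W)) : Ck k D snd.
Proof.
have l : linear (snd : V * W -> W) by [].
pose L : {linear (V * W)%type -> W} :=
  HB.pack (snd : V * W -> W) (GRing.isLinear.Build _ _ _ _ _ l).
by apply: (@Ck_linear_map _ _ _ L) => q; exact: cvg_snd.
Qed.

Lemma Ck_comp_pair (R : realType) (V W : normedModType R) k (D : set V)
    (D' : set W) (f : V -> W) (g : W -> R * R) :
  finite_basis W -> open D -> open D' -> (forall x, D x -> D' (f x)) ->
  Ck k D f -> Ck k D' g -> Ck k D (g \o f).
Proof.
move=> bW oD oD' DD' hf /(Ck_pair _ _ oD')[g1 g2].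
apply/(Ck_pair _ _ oD); split.
  exact: (Ck_comp_scalar bW oD oD' DD' hf g1).
exact: (Ck_comp_scalar bW oD oD' DD' hf g2).
Qed.

(** * Arithmetic of smooth complex-valued functions *)

Section ComplexCk.
Variables (R : realType) (V : normedModType R) (k : nat) (D : set V).
Hypothesis oD : open D.
Implicit Types (f g : V -> R[i]) (r : V -> R).

Lemma Ck_Re f : Ck k D (fun p => reim (f p)) -> Ck k D (fun p => complex.Re (f p)).
Proof. by move=> /(Ck_pair _ _ oD)[]. Qed.

Lemma Ck_reim_real r : Ck k D r -> Ck k D (fun p => reim (r p)%:C%C).
Proof.
move=> hr; apply/(Ck_pair _ _ oD); split; first exact: hr.
exact: (Ck_cst k D (0 : R)).
Qed.

Lemma Ck_reim_conj f : Ck k D (fun p => reim (f p)) ->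
  Ck k D (fun p => reim (f p)^*%C).
Proof.
move=> /(Ck_pair _ _ oD)[f1 f2]; apply/(Ck_pair _ _ oD); split.
  by apply: Ck_congr f1 => // x _ /=; case: (f x).
by apply: Ck_congr (CkN oD f2) => // x _; rewrite !fctE /=; case: (f x).
Qed.

Lemma Ck_reimD f g : Ck k D (fun p => reim (f p)) -> Ck k D (fun p => reim (g p)) ->
  Ck k D (fun p => reim (f p + g p)).
Proof.
move=> hf hg; apply: Ck_congr (CkD oD hf hg) => // x _; rewrite !fctE.
by case: (f x) (g x) => ? ? [].
Qed.

Lemma Ck_realV r : (forall x, D x -> r x != 0) -> Ck k D r -> Ck k D (fun x => (r x)^-1).
Proof.
move=> r0 hr.
by apply: (Ck_comp_scalar (finite_basis_R R) oD (@open_neq R 0 : open _) r0 hr);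
  exact: Ck_inv.
Qed.

Lemma Ck_real_sqrt r : (forall x, D x -> 0 < r x) -> Ck k D r ->
  Ck k D (fun x => Num.sqrt (r x)).
Proof.
move=> r0 hr.
by apply: (Ck_comp_scalar (finite_basis_R R) oD (@open_gt R 0 : open _) r0 hr);
  exact: Ck_sqrt.
Qed.

(** Reduces to inversion of a real function: the inverse of z is its conjugate divided by |z|^2. *)
Lemma Ck_reimV f : (forall x, D x -> f x != 0) ->
  Ck k D (fun p => reim (f p)) -> Ck k D (fun p => reim (f p)^-1).
Proof.
move=> f0 hf.
have n0 z : z != 0 -> complex.Re (z * z^*%C) != 0 :> R.
  move=> z0; rewrite -sqr_normc; have : 0 < `|z| ^+ 2 by rewrite exprn_gt0 ?normr_gt0.
  by rewrite ltcE => /andP[_ h]; rewrite gt_eqF.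
have E x : D x -> (complex.Re (f x * (f x)^*%C))^-1%:C%C * (f x)^*%C = (f x)^-1.
  move=> /f0 fx0; rewrite fmorphV /= RRe_real; last first.
    by rewrite -sqr_normc rpredX ?normr_real.
  by rewrite invfM mulfVK // conjc_eq0.
apply: (Ck_congr (f := fun x => reim
    ((complex.Re (f x * (f x)^*%C))^-1%:C%C * (f x)^*%C))) => // [x /E -> //|].
apply: reimM => //; last exact: Ck_reim_conj.
apply: Ck_reim_real; apply: Ck_realV => [x /f0|]; first exact: n0.
by apply: Ck_Re; apply: reimM => //; exact: Ck_reim_conj.
Qed.

End ComplexCk.

(** * Smooth functions on the base times the fibre *)

Section SmoothOver.
Variables (R : realType) (M : topologicalType) (E : normedModType R).
Variables (A : set (chart M E)) (S : normedModType R) (F : Type) (par : S -> F).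
Variable W : set M.
Hypothesis oW : open W.
Implicit Types f g : M -> F -> R[i].

Lemma smooth_over_congr f g : (forall x s, W x -> f x s = g x s) ->
  smooth_over A par W f -> smooth_over A par W g.
Proof.
move=> fg h c Ac k; apply: Ck_congr (h c Ac k); first exact: fibred_dom_open.
by move=> p [_ Wp]; rewrite fg.
Qed.

Lemma smooth_over_cst z : smooth_over A par W (fun _ _ => z).
Proof. by move=> c Ac k; exact: Ck_cst. Qed.

Lemma smooth_over_conj f : smooth_over A par W f ->
  smooth_over A par W (fun x s => (f x s)^*%C).
Proof. by move=> h c Ac k; apply: Ck_reim_conj (h c Ac k); exact: fibred_dom_open. Qed.

Lemma smooth_overD f g : smooth_over A par W f -> smooth_over A par W g ->
  smooth_over A par W (fun x s => f x s + g x s).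
Proof.
move=> hf hg c Ac k.
by apply: Ck_reimD (hf c Ac k) (hg c Ac k); exact: fibred_dom_open.
Qed.

Lemma smooth_overV f : (forall x s, W x -> f x s != 0) ->
  smooth_over A par W f -> smooth_over A par W (fun x s => (f x s)^-1).
Proof.
move=> f0 h c Ac k; apply: Ck_reimV (h c Ac k); first exact: fibred_dom_open.
by move=> p [_ Wp]; exact: f0.
Qed.

Lemma smooth_over_sqrt f : (forall x s, W x -> 0 < complex.Re (f x s)) ->
  smooth_over A par W f ->
  smooth_over A par W (fun x s => (Num.sqrt (complex.Re (f x s)))%:C%C).
Proof.
move=> f0 h c Ac k; have oD := fibred_dom_open (S := S) (c := c) oW.
apply: Ck_reim_real => //; apply: Ck_real_sqrt => //.
  by move=> p [_ Wp]; exact: f0.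
by apply: Ck_Re => //; exact: h.
Qed.

(** The modulus is the real square root of f times its conjugate, and this product stays in the
    domain where the root is smooth as long as f has no zero. *)
Lemma smooth_over_norm f : (forall x s, W x -> f x s != 0) ->
  smooth_over A par W f -> smooth_over A par W (fun x s => `|f x s|).
Proof.
move=> f0 h.
apply: (@smooth_over_congr (fun x s =>
    (Num.sqrt (complex.Re (f x s * (f x s)^*%C)))%:C%C)).
  move=> x s _; rewrite normc_def; congr (Num.sqrt _)%:C%C.
  by case: (f x s) => a b /=; rewrite mulrN opprK !expr2.
apply: smooth_over_sqrt.
  move=> x s Wx; rewrite -sqr_normc.
  have : 0 < `|f x s| ^+ 2 by rewrite exprn_gt0 ?normr_gt0 ?f0.
  by rewrite ltcE => /andP[].
by apply: smooth_over_mul => //; exact: smooth_over_conj.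
Qed.

(** One direction precomposes with the projection to the base, the other with its section y |-> (y,
    0). Since [par] is arbitrary, functions of x alone can pass between different fibres. *)
Lemma smooth_fun_over a : smooth_fun A W a <-> smooth_over A par W (fun x _ => a x).
Proof.
split=> h c Ac k.
  exact: (@Ck_affine _ _ _ _ (fst : E * S -> E) fst (fun _ _ _ => erefl)
    (@fst_diff _ _ _) k _ _ (h c Ac k)).
have AB (y v : E) (b : R) : (b *: v + y, 0) = b *: ((v, 0) : E * S) + (y, 0).
  by congr pair; rewrite /= scaler0 addr0.
have dA (y : E) : differentiable (fun y : E => (y, 0 : S)) y.
  by apply: differentiable_pair.
exact: (Ck_affine AB dA (h c Ac k)).
Qed.

(** Provides the neighbourhoods on which local roots are taken. Continuity of f is known only in
    charts, so positivity near the point is carried back to M by [cfun_cts]. *)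
Lemma smooth_over_open f (s : S) : (forall x, exists2 c, A c & cdom c x) ->
  smooth_over A par W f -> open [set x | W x /\ 0 < complex.Re (f x (par s))].
Proof.
move=> cov h; rewrite openE => x [Wx fx].
have [c Ac cx] := cov x.
have cy : fibred_dom c W (cfun c x, s).
  by split; [exact: cfun_rng|rewrite /= cfunK].
have /(_ _ cy) hc := Ck_Re (fibred_dom_open (S := S) (c := c) oW) (h c Ac 0%N).
have hy : {for cfun c x, continuous (fun y => complex.Re (f (cinv c y) (par s)))}.
  apply: (@continuous_comp _ _ _ (fun y : E => (y, s)) _ _ _ hc).
  by apply: cvg_pair; [exact: cvg_id|exact: cvg_cst].
have P : \forall y \near cfun c x, 0 < complex.Re (f (cinv c y) (par s)).
  apply: (hy [set z | 0 < z]); apply: open_nbhs_nbhs; split; first exact: open_gt.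
  by rewrite /= cfunK.
have P' := cfun_cts cx P.
near=> z; split.
  by near: z; exact: open_nbhs_nbhs.
have cz : cdom c z by near: z; apply: open_nbhs_nbhs; split=> //; exact: cdom_open.
by rewrite -(cfunK cz); near: z.
Unshelve. all: by end_near. Qed.

End SmoothOver.

(** * Change of atlas *)

Section ChangeOfCharts.
Variables (R : realType) (M : topologicalType) (E E' : normedModType R).
Variables (A : set (chart M E)) (A' : set (chart M E')).
Variables (S : normedModType R) (F : Type) (par : S -> F).

(** The two model spaces may differ, so that this serves in both directions between the real and the
    complex charts of M; the fibre coordinate is carried along unchanged. *)
Lemma smooth_over_change W f : finite_basis E -> finite_basis S -> open W ->
  (forall x, exists2 c, A c & cdom c x) ->
  (forall c c', A c -> A' c' -> smooth (transition_dom c' c) (cfun c \o cinv c')) ->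
  smooth_over A par W f -> smooth_over A' par W f.
Proof.
move=> bE bS oW cov tr h c' Ac' k; apply: Ck_point => -[y s] [/= cy Wy].
have [c Ac cx] := cov (cinv c' y).
have oWc : open (W `&` cdom c) by apply: openI => //; exact: cdom_open.
exists (fibred_dom c' (W `&` cdom c)) => //.
have oD := fibred_dom_open (S := S) (c := c') oWc.
pose T (p : E' * S) : E * S := (cfun c (cinv c' p.1), p.2).
apply: (Ck_congr (f := (fun p : E * S => reim (f (cinv c p.1) (par p.2))) \o T)).
- exact: oD.
- by move=> p [_ [_ cp]]; rewrite /T /= cfunK.
- apply: (Ck_comp_pair (D' := fibred_dom c W)).
  + exact: finite_basis_prod.
  + exact: oD.
  + exact: fibred_dom_open.
  + by move=> p [? [? ?]]; rewrite /T; split=> /=; [exact: cfun_rng|rewrite cfunK].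
  + apply/(Ck_pair _ _ oD); split; last exact: Ck_snd.
    have := @Ck_affine _ _ _ _ (fst : E' * S -> E') fst (fun _ _ _ => erefl)
      (@fst_diff _ _ _) k _ _ (tr c c' Ac Ac' k).
    apply: Ck_sub.
    by move=> p [? [? ?]]; split.
  + exact: h.
Qed.

End ChangeOfCharts.

(** * Local square roots of nonvanishing functions *)

Section LocalSquareRoot.
Variable R : realType.

(** This quantity is the square of the denominator in [principal_sqrt]. *)
Lemma Re_add_norm_gt0 (w : R[i]) : 0 < complex.Re w ->
  0 < complex.Re (2 * (w + `|w|)).
Proof.
move=> w0; rewrite mulrDr normc_def.
have -> (z y : R[i]) : complex.Re (2 * z + 2 * y) = 2 * complex.Re z + 2 * complex.Re y.
  by case: z y => ? ? [] ? ? /=; ring.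
by apply: ltr_pwDl; rewrite ?mulr_gt0 // mulr_ge0 // sqrtr_ge0.
Qed.

(* (w + |w|)^2 = w (w + w^* + 2 |w|), whence the principal square root of w *)
Lemma principal_sqrt (w : R[i]) : 0 < complex.Re w ->
  ((w + `|w|) * (Num.sqrt (complex.Re (2 * (w + `|w|))))%:C%C^-1) ^+ 2 = w.
Proof.
move=> w0.
have E : (complex.Re (2 * (w + `|w|)))%:C%C = w + w^*%C + 2 * `|w|.
  rewrite addcJ normc_def; case: w {w0} => a b /=.
  by apply/eqP; rewrite eq_complex /=; apply/andP; split; apply/eqP; ring.
have p := Re_add_norm_gt0 w0.
rewrite exprMn exprVn -rmorphXn /= sqr_sqrtr ?ltW // E.
have -> : (w + `|w|) ^+ 2 = w * (w + w^*%C + 2 * `|w|).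
  by rewrite sqrrD sqr_normc; ring.
rewrite mulfK // -E; apply: contraTneq p => /complexI ->.
by rewrite ltxx.
Qed.

Variables (M : topologicalType) (E : normedModType R).
Variables (A : set (chart M E)) (S : normedModType R) (F : Type) (par : S -> F).

(** Dividing by the constant [a x] gives a function with value 1 at x, hence near x in the right
    half-plane, where the principal root is smooth. The factor [sqrtc (a x)] put back is a constant,
    so the discontinuity of [sqrtc] does no harm. *)
Lemma smooth_over_local_sqrt W (a : M -> R[i]) x : open W ->
  (forall y, exists2 c, A c & cdom c y) -> W x -> a x != 0 ->
  smooth_over A par W (fun y _ => a y) ->
  exists W' d, [/\ open W', W' x, W' `<=` W,
    smooth_over A par W' (fun y _ => d y) & forall y, W' y -> d y ^+ 2 = a y].
Proof.
move=> oW cov Wx ax sa.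
pose w y := a y * (a x)^-1.
have sw : smooth_over A par W (fun y _ => w y).
  by apply: smooth_over_mul => //; exact: smooth_over_cst.
pose W' := [set y | W y /\ 0 < complex.Re (w y)].
have oW' : open W' by exact: (smooth_over_open oW 0 cov sw).
have W'W : W' `<=` W by move=> y [].
have sw' : smooth_over A par W' (fun y _ => w y).
  by move=> c Ac k; apply: Ck_sub (sw c Ac k) => p [? /W'W].
pose d y := sqrtc (a x) *
  ((w y + `|w y|) * (Num.sqrt (complex.Re (2 * (w y + `|w y|))))%:C%C^-1).
have w0 y : W' y -> w y != 0.
  by move=> [_]; apply: contraTneq => ->; rewrite ltxx.
have s1 : smooth_over A par W' (fun y _ => w y + `|w y|).
  apply: smooth_overD => //; apply: smooth_over_norm => // y _; exact: w0.
have p y : W' y -> 0 < complex.Re (2 * (w y + `|w y|)).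
  by move=> [_]; exact: Re_add_norm_gt0.
exists W', d; split=> //.
- by split=> //; rewrite /w divff //= ltr01.
- apply: smooth_over_mul => //; first exact: smooth_over_cst.
  apply: smooth_over_mul => //; apply: smooth_overV => //.
    move=> y _ /p h; apply: contraTneq h => /complexI/eqP.
    by rewrite sqrtr_eq0 -leNgt.
  apply: smooth_over_sqrt => //; first by move=> y _; exact: p.
  by apply: smooth_over_mul => //; exact: smooth_over_cst.
- move=> y [_ wy]; rewrite /d exprMn sqr_sqrtc principal_sqrt //.
  by rewrite mulrC divfK.
Qed.

End LocalSquareRoot.

(** * Equivalences of categories *)

Local Notation hom := Defs.hom.

Section Equivalences.

Lemma equivalent_sym (C D : category) : equivalent C D -> equivalent D C.
Proof. by move=> [F [G [FG GF]]]; exists G, F. Qed.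

Definition isomorphic (C : category) (a b : C) :=
  exists (u : hom a b) (v : hom b a),
    comphom u v = idhom a /\ comphom v u = idhom b.

Lemma isomorphic_refl (C : category) (a : C) : isomorphic a a.
Proof. by exists (idhom a), (idhom a); rewrite comp1hom. Qed.

(** Choice picks the preimages of objects with their isomorphisms; a morphism of D is conjugated by
    these and pulled back through the bijection that F induces on morphisms. Functoriality is then
    checked after applying F. *)
Lemma equivalent_fully_faithful (C D : category) (F : functor C D) :
  (forall a b, injective (@fhom _ _ F a b)) ->
  (forall a b (g : hom (F a) (F b)), exists f, fhom F f = g) ->
  (forall d, exists c, isomorphic (F c) d) ->
  equivalent C D.
Proof.
move=> faith full esurj.
have [G0 isoG] := choice esurj.
pose u d := projT1 (cid (isoG d)); pose u' d := cid (projT2 (cid (isoG d))).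
pose v d := projT1 (u' d); have uv d := projT2 (u' d).
rewrite -/(u _) -/(v _) in uv.
have lift a b : {k : hom (F a) (F b) -> hom a b & forall g, fhom F (k g) = g}.
  by have [h hK] := choice (full a b); exists h.
pose k a b := projT1 (lift a b).
have kK a b (g : hom (F a) (F b)) : fhom F (k a b g) = g := projT2 (lift a b) g.
have Fk a b (f : hom a b) : k a b (fhom F f) = f by apply: faith; rewrite kK.
pose G1 a b (g : hom a b) : hom (G0 a) (G0 b) :=
  k _ _ (comphom (u a) (comphom g (v b))).
have G1id a : G1 a a (idhom a) = idhom (G0 a).
  by apply: faith; rewrite kK comp1hom (uv a).1 fhom_id.
have G1comp a b c (f : hom a b) (g : hom b c) :
    G1 a c (comphom f g) = comphom (G1 _ _ f) (G1 _ _ g).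
  apply: faith; rewrite fhom_comp !kK -!comphomA; congr comphom.
  by rewrite [in RHS](comphomA (v b)) (uv b).2 comp1hom.
pose G := @Functor D C G0 G1 G1id G1comp.
exists F, G; split.
- exists (fun a => k (G0 (F a)) a (u (F a))), (fun a => k a (G0 (F a)) (v (F a))).
  split=> [a|a b f].
    by split; apply: faith; rewrite fhom_comp !kK fhom_id; have [] := uv (F a).
  apply: faith; rewrite /= !fhom_comp !kK -!comphomA; congr comphom.
  by rewrite (uv (F b)).2 comphom1.
- exists u, v; split=> [a|a b f]; first exact: uv.
  by rewrite /= kK -!comphomA (uv b).2 comphom1.
Qed.

Lemma equivalent_trans (C D E : category) :
  equivalent C D -> equivalent D E -> equivalent C E.
Proof.
move=> [F [F' [[a [a' [aK aN]]] [b [b' [bK bN]]]]]].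
move=> [G [G' [[c [c' [cK cN]]] [d [d' [dK dN]]]]]].
exists (functor_comp F G), (functor_comp G' F'); split.
- exists (fun x => comphom (fhom F' (c (F x))) (a x)),
    (fun x => comphom (a' x) (fhom F' (c' (F x)))); split=> [x|x y f] /=.
    split.
      rewrite -comphomA (comphomA (a x)) (aK x).1 comp1hom -fhom_comp (cK _).1.
      by rewrite fhom_id.
    rewrite -comphomA (comphomA (fhom F' _)) -fhom_comp (cK _).2 fhom_id comp1hom.
    exact: (aK x).2.
  have := cN _ _ (fhom F f); have /= := aN _ _ f => ha hc.
  rewrite -comphomA ha !comphomA -!fhom_comp; congr comphom; congr fhom.
  exact: hc.
- exists (fun x => comphom (fhom G (b (G' x))) (d x)),
    (fun x => comphom (d' x) (fhom G (b' (G' x)))); split=> [x|x y f] /=.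
    split.
      rewrite -comphomA (comphomA (d x)) (dK x).1 comp1hom -fhom_comp (bK _).1.
      by rewrite fhom_id.
    rewrite -comphomA (comphomA (fhom G _)) -fhom_comp (bK _).2 fhom_id comp1hom.
    exact: (dK x).2.
  have := bN _ _ (fhom G' f); have /= := dN _ _ f => hd hb.
  rewrite -comphomA hd !comphomA -!fhom_comp; congr comphom; congr fhom.
  exact: hb.
Qed.

End Equivalences.

(** * Frames of line bundles *)

Section Regular.
Variables (R : realType) (M : topologicalType) (F : fibre R) (O : regularity M F).

Lemma regular_congr W f g : open W -> (forall x s, W x -> f x s = g x s) ->
  O W f -> O W g.
Proof.
move=> oW fg h; apply: regular_local => // x Wx.
by exists W, f; split=> // y s Wy _; exact: fg.
Qed.

(** The exponent starts at 1 because the axioms of [regularity] do not provide the constant 1. Hence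
    [k := 0] stands for linear maps below and [k := 1] for quadratic ones. *)
Lemma regularX W f k : open W -> O W f -> O W (fun x s => f x s ^+ k.+1).
Proof.
move=> oW h; elim: k => [|k IH].
  by apply: regular_congr h => // x s _; rewrite expr1.
apply: (@regular_congr W (fun x s => f x s * f x s ^+ k.+1)) => //.
exact: regular_mul oW h IH.
Qed.

End Regular.

Section Frames.
Variables (R : realType) (n : nat) (M : manifold R n) (O : regularity M (line_fibre R)).
Variable N : line_bundle O.
Implicit Types (t : ltriv (line_fibre R) (fun y => N y)) (x : M).

Definition coef t x (v : N x) : R[i] := tfun t v.
Definition frame t x : N x := tinv t x (1 : R[i]).

Variables (t : ltriv (line_fibre R) (fun y => N y)) (x : M).
Hypotheses (Nt : ltrivs (latlas N) t) (tx : tdom t x).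

Lemma coef_linear : scalar (@coef t x).
Proof. exact: ltriv_linear Nt tx. Qed.

Lemma coef_inj : injective (@coef t x).
Proof. exact: can_inj (tfunK tx). Qed.

Lemma coef0 : coef t (0 : N x) = 0.
Proof.
by have := coef_linear (-1) 0 0; rewrite scaler0 addr0 mulN1r addNr.
Qed.

Lemma coefZ a (v : N x) : coef t (a *: v) = a * coef t v.
Proof. by have := coef_linear a v 0; rewrite addr0 coef0 addr0. Qed.

Lemma coef_tinv (z : R[i]) : coef t (tinv t x z : N x) = z.
Proof. exact: (tinvK tx). Qed.

Lemma coef_frame : coef t (frame t x) = 1.
Proof. exact: coef_tinv. Qed.

Lemma tinv_frame (z : R[i]) : (tinv t x z : N x) = z *: frame t x.
Proof. by apply: coef_inj; rewrite coef_tinv coefZ coef_frame mulr1. Qed.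

Lemma coef_frameK (v : N x) : coef t v *: frame t x = v.
Proof. by apply: coef_inj; rewrite coefZ coef_frame mulr1. Qed.

Lemma coef_eq0 (v : N x) : (coef t v == 0) = (v == 0).
Proof. by rewrite -coef0 (inj_eq coef_inj). Qed.

Lemma frame_neq0 : frame t x != 0.
Proof. by rewrite -coef_eq0 coef_frame oner_neq0. Qed.

End Frames.

(** * Homogeneous maps between lines *)

Section LineMaps.
Variables (R : realType) (n : nat) (M : manifold R n) (O : regularity M (line_fibre R)).
Implicit Types N L : line_bundle O.

Lemma line_span N x (u v : N x) : u != 0 -> exists a, v = a *: u.
Proof.
move=> u0; have [t Nt tx] := ltriv_cover (latlas N) x.
exists (coef t v / coef t u); apply: (coef_inj tx).
by rewrite (coefZ Nt tx) divfK // coef_eq0.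
Qed.

(** A nonzero v spans the fibre, so if f vanished at v it would vanish identically by
    homogeneity. *)
Lemma line_homog_eq0 N L x k (f : N x -> L x) (v : N x) :
  (forall a u, f (a *: u) = a ^+ k.+1 *: f u) ->
  (exists u, f u != 0) -> (f v == 0) = (v == 0).
Proof.
move=> hf [u u0]; apply/eqP/eqP => [fv|->]; last first.
  by rewrite -(scale0r (0 : N x)) hf expr0n /= scale0r.
apply/eqP; apply: contraNT u0 => v0.
by have [a ->] := line_span u v0; rewrite hf fv scaler0.
Qed.

(** In frames f is z |-> z^(k+1) c(x), with c the coordinate of the image of the frame; this reduces
    regularity on the total space to regularity of c on the base. *)
Lemma line_map_homogP N L k (f : forall x, N x -> L x) :
  (forall W, O W (fun _ s => s)) ->
  (forall x a v, f x (a *: v) = a ^+ k.+1 *: f x v) ->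
  line_map_regular f <-> (forall t t', ltrivs (latlas N) t -> ltrivs (latlas L) t' ->
    O (tdom t `&` tdom t') (fun x _ => coef t' (f x (frame t x)))).
Proof.
move=> Oid hf; split=> h t t' Nt Lt'; first exact: regular_one (h t t' Nt Lt').
have oW : open (tdom t `&` tdom t') by apply: openI; exact: tdom_open.
have hs : O (tdom t `&` tdom t')
    (fun x s => (s : R[i]) ^+ k.+1 * coef t' (f x (frame t x))).
  by apply: regular_mul (h t t' Nt Lt'); [exact: oW|apply: regularX].
apply: regular_congr hs => // x s [tx t'x] /=; rewrite (tinv_frame Nt tx) hf.
by rewrite -(coefZ Lt' t'x).
Qed.

Lemma linear_scale N L x (f : N x -> L x) : linear f ->
  forall a v, f (a *: v) = a ^+ 1 *: f v.
Proof.
move=> lf a v; have f0 : f 0 = 0.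
  by have := lf (-1) 0 0; rewrite scaler0 addr0 scaleN1r addNr.
by have := lf a v 0; rewrite addr0 f0 addr0.
Qed.

(** With e a frame, f (a e) = a^2 f e, so the polarization at a e and b e is 2 a b f e. *)
Lemma square_quadratic N L x (f : N x -> L x) :
  (forall a v, f (a *: v) = a ^+ 2 *: f v) -> quadratic_map f.
Proof.
move=> hf; split=> // u a v w; have [t Nt tx] := ltriv_cover (latlas N) x.
rewrite -(coef_frameK Nt tx u) -(coef_frameK Nt tx v) -(coef_frameK Nt tx w).
rewrite !scalerA -!scalerDl !hf -!scalerBl scalerA -scalerDl.
by congr (_ *: _); ring.
Qed.

Lemma square_surjective N L x (f : N x -> L x) :
  (forall a v, f (a *: v) = a ^+ 2 *: f v) -> (exists u, f u != 0) ->
  forall w, exists v, f v = w.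
Proof.
move=> hf [u u0] w; have [a ->] := line_span w u0.
by exists (sqrtc a *: u); rewrite hf sqr_sqrtc.
Qed.

End LineMaps.

Section SmoothIso.
Variables (R : realType) (n : nat) (M : manifold R n).
Variables N L : line_bundle (smooth_line M).

(** The inverse reads z |-> z / a where f reads z |-> a z, and 1 / a is smooth. A general
    [regularity] has no such inversion, so for holomorphic roots the inverse is handled by a
    separate argument. *)
Lemma smooth_line_iso (f : forall x, N x -> L x) :
  (forall x, linear (f x)) -> line_map_regular f ->
  (forall x v, f x v = 0 -> v = 0) -> line_iso f.
Proof.
move=> lf sf f0; split=> //.
have fZ x := linear_scale (lf x).
have surj x (w : L x) : exists v, f x v = w.
  have [t Nt tx] := ltriv_cover (latlas N) x.
  have fe : f x (frame t x) != 0.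
    by apply: contra (frame_neq0 Nt tx) => /eqP/f0/eqP.
  by have [a ->] := line_span w fe; exists (a *: frame t x); rewrite fZ expr1.
pose f' x (w : L x) := projT1 (cid (surj x w)).
have f'K x : cancel (f' x) (f x) by move=> w; exact: projT2 (cid (surj x w)).
have fK x : cancel (f x) (f' x).
  move=> v; apply/eqP; rewrite -subr_eq0; apply/eqP/f0.
  by rewrite addrC -scaleN1r lf f'K scaleN1r addNr.
have f'Z x a w : f' x (a *: w) = a ^+ 1 *: f' x w.
  by apply: (can_inj (fK x)); rewrite fZ !f'K.
exists f' => //; apply/(line_map_homogP (k := 0) (@smooth_line_id _ _ _) f'Z).
move=> t t' Lt Nt'; have oW : open (tdom t `&` tdom t') by apply: openI; exact: tdom_open.
have /(line_map_homogP (k := 0) (@smooth_line_id _ _ _) fZ)/(_ _ _ Nt' Lt) h := sf.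
rewrite setIC in oW *.
have E x : (tdom t' `&` tdom t) x ->
    coef t' (f' x (frame t x)) * coef t (f x (frame t' x)) = 1.
  move=> [t'x tx]; rewrite mulrC -(coefZ Nt' t'x) -[X in X *: _]expr1 -f'Z.
  by rewrite (coef_frameK Lt tx) fK (coef_frame t'x).
apply: (smooth_over_congr oW (f := fun x _ => (coef t (f x (frame t' x)))^-1)).
  move=> x _ /E h1; rewrite -[LHS]mul1r -h1 mulfK //.
  by apply/eqP => h0; move/eqP: h1; rewrite h0 mulr0 eq_sym oner_eq0.
apply: smooth_overV => // x _ /E h1; apply/eqP => h0.
by move/eqP: h1; rewrite h0 mulr0 eq_sym oner_eq0.
Qed.

End SmoothIso.

(** * The square map of a root *)

Section SquareRootMaps.
Variables (R : realType) (n : nat) (M : manifold R n) (O : regularity M (line_fibre R)).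
Variables (L : line_bundle O) (N : square_root L).

Lemma sqrt_mapZ x a (v : N x) : sqrt_map (a *: v) = a ^+ 2 *: sqrt_map v.
Proof. exact: (sqrt_quadratic N x).1. Qed.

(** Surjectivity supplies the vector with nonzero image that [line_homog_eq0] asks for. *)
Lemma sqrt_map_eq0 x (v : N x) : (sqrt_map v == 0) = (v == 0).
Proof.
apply: line_homog_eq0; first exact: sqrt_mapZ.
have [t Lt tx] := ltriv_cover (latlas L) x.
by have [u uE] := sqrt_surjective N (frame t x); exists u; rewrite uE (frame_neq0 Lt tx).
Qed.

Lemma sqrt_regular_frame t t' : (forall W, O W (fun _ s => s)) ->
  ltrivs (latlas N) t -> ltrivs (latlas L) t' ->
  O (tdom t `&` tdom t') (fun x _ => coef t' (sqrt_map (frame t x))).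
Proof.
move=> Oid Nt Lt'.
have [h _] := line_map_homogP (k := 1) Oid sqrt_mapZ.
exact: h (@sqrt_regular _ _ _ _ _ N) _ _ Nt Lt'.
Qed.

Lemma sqrt_hom_eq (N' : square_root L) (f g : sqrt_hom N N') :
  (forall x (v : N x), sval f x v = sval g x v) -> f = g.
Proof.
case: f g => [f hf] [g hg] /= fg; apply: eq_exist.
by apply: functional_extensionality_dep => x; apply/funext => v.
Qed.

End SquareRootMaps.

(** * Hermitian square roots *)

Section HermitianForms.
Variables (R : realType) (n : nat) (M : manifold R n).
Variables (L : line_bundle (smooth_line M)) (h : hermitian_metric L).

Lemma hform0 x (w : L x) : h x 0 w = 0.
Proof.
by have := hform_linear h w (-1) 0 0; rewrite scaler0 addr0 mulN1r addNr.
Qed.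

Lemma hformZl x a (v w : L x) : h x (a *: v) w = a * h x v w.
Proof. by have := hform_linear h w a v 0; rewrite addr0 hform0 addr0. Qed.

Lemma hformZr x a (v w : L x) : h x v (a *: w) = a^*%C * h x v w.
Proof. by rewrite hform_conj hformZl [LHS]rmorphM /= -hform_conj. Qed.

Lemma hformZ x a (v : L x) : h x (a *: v) (a *: v) = `|a| ^+ 2 * h x v v.
Proof. by rewrite hformZl hformZr mulrA sqr_normc. Qed.

Lemma hform_ge0 x (v : L x) : 0 <= h x v v.
Proof.
by have [->|v0] := eqVneq v 0; rewrite ?hform0 // ltW // hform_pos.
Qed.

Lemma hform_real x (v : L x) : (complex.Re (h x v v))%:C%C = h x v v.
Proof. by rewrite RRe_real // ger0_real // hform_ge0. Qed.

Lemma hform_re_gt0 x (v : L x) : v != 0 -> 0 < complex.Re (h x v v).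
Proof. by move=> v0; rewrite -ltcR hform_real hform_pos. Qed.

(** A metric is only assumed smooth on vectors with constant coordinates; for a section c e with c
    smooth, sesquilinearity multiplies h(e, e) by |c|^2. *)
Lemma hform_smooth_section W (u : forall x, L x) : open W ->
  (forall t, ltrivs (latlas L) t ->
     smooth_line M (W `&` tdom t) (fun x _ => coef t (u x))) ->
  smooth_line M W (fun x _ => h x (u x) (u x)).
Proof.
move=> oW su; apply: (regular_local (r := smooth_line M)) => // x Wx.
have [t Lt tx] := ltriv_cover (latlas L) x.
have oWt : open (W `&` tdom t) by apply: openI => //; exact: tdom_open.
exists (W `&` tdom t), (fun y _ =>
  coef t (u y) * (coef t (u y))^*%C * h y (frame t y) (frame t y)); split=> //.
  have sc := su t Lt.
  apply: smooth_over_mul => //.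
    by apply: smooth_over_mul => //; exact: smooth_over_conj.
  have := hform_smooth h (1 : R[i]) 1 Lt.
  move=> /(smooth_fun_over (atlas M) (@ofpair R) (tdom t)).
  apply: (regular_sub (O := smooth_line M)) => [||y []] //; exact: tdom_open.
move=> y _ _ [_ ty]; rewrite -[in RHS](coef_frameK Lt ty (u y)).
by rewrite hformZl hformZr mulrA.
Qed.

End HermitianForms.

(** * The metric determined by the square map *)

Section ForgetMetric.
Variables (R : realType) (n : nat) (M : manifold R n).
Variables (L : line_bundle (smooth_line M)) (h : hermitian_metric L).

(** [herm_unit] concerns unit vectors only. A general v is s u with u of length 1 and |s|^2 the
    squared length of v, and the square map turns s into s^2. *)
Lemma herm_root_sqr (N : hermitian_root h) x (v : N x) :
  h x (sqrt_map v) (sqrt_map v) = herm_metric N x v v ^+ 2.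
Proof.
have [->|v0] := eqVneq v 0.
  have /eqP -> : sqrt_map (0 : N x) == 0 by rewrite sqrt_map_eq0.
  by rewrite !hform0 expr0n.
set r := herm_metric N x v v.
have r0 : 0 < r by exact: hform_pos.
pose s := sqrtC r; have s0 : 0 < s by rewrite sqrtC_gt0.
have ns : `|s| ^+ 2 = r by rewrite ger0_norm ?ltW // sqrtCK.
have u1 : herm_metric N x (s^-1 *: v) (s^-1 *: v) = 1.
  by rewrite hformZ normfV exprVn ns mulVf // gt_eqF.
have -> : v = s *: (s^-1 *: v) by rewrite scalerA divff ?gt_eqF // scale1r.
by rewrite sqrt_mapZ hformZ (herm_unit u1) mulr1 normrX ns.
Qed.

(** A sesquilinear form on a line is known from its value on one vector; the two values are
    nonnegative and their squares agree by [herm_root_sqr]. *)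
Lemma herm_unitary (N N' : hermitian_root h) (f : sqrt_hom N N') :
  @unitary _ _ _ _ _ N N' (sval f).
Proof.
case: f => f [[lf _ _] qf] x v w /=.
have [t Nt tx] := ltriv_cover (latlas N) x.
set u := frame t x.
rewrite -(coef_frameK Nt tx v) -(coef_frameK Nt tx w) -/u.
have fZ a y : f x (a *: y) = a *: f x y by rewrite (linear_scale (lf x)) expr1.
rewrite !fZ !hformZl !hformZr; do 2 congr (_ * _).
apply/eqP; rewrite -(eqrXn2 (n := 2)) ?hform_ge0 //.
by rewrite -!herm_root_sqr qf.
Qed.

Section RootMetric.
Variable N : square_root L.

(** This is the squared length of v, that is |q v|; hence the factor |a|^2 in [root_normZ]. *)
Definition root_norm x (v : N x) : R[i] :=
  (Num.sqrt (complex.Re (h x (sqrt_map v) (sqrt_map v))))%:C%C.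

Lemma root_normZ x a (v : N x) : root_norm (a *: v) = `|a| ^+ 2 * root_norm v.
Proof.
rewrite /root_norm sqrt_mapZ hformZ normrX -hform_real.
have -> : `|a| ^+ 2 = (complex.Re a ^+ 2 + complex.Im a ^+ 2)%:C%C.
  by rewrite add_Re2_Im2.
rewrite -rmorphXn -rmorphM /= sqrtrM ?exprn_ge0 ?addr_ge0 ?sqr_ge0 //.
by rewrite sqrtr_sqr ger0_norm ?addr_ge0 ?sqr_ge0 // rmorphM.
Qed.

Lemma root_norm_sqr x (v : N x) :
  root_norm v ^+ 2 = h x (sqrt_map v) (sqrt_map v).
Proof.
rewrite /root_norm -rmorphXn /= sqr_sqrtr ?hform_real //.
by rewrite -lecR hform_real hform_ge0.
Qed.

Lemma root_norm_gt0 x (v : N x) : v != 0 -> 0 < root_norm v.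
Proof. by move=> v0; rewrite /root_norm ltcR sqrtr_gt0 hform_re_gt0 ?sqrt_map_eq0. Qed.

(** A sesquilinear form needs a frame to be recovered from its squared length. The frame is chosen
    separately at each x, with no continuity; [root_formZ] shows that any other vector gives the
    same form, and smoothness is checked through it. *)
Definition root_form x (v w : N x) : R[i] :=
  let t := s2val (cid2 (ltriv_cover (latlas N) x)) in
  coef t v * (coef t w)^*%C * root_norm (frame t x).

Lemma root_formZ x (u : N x) a b :
  root_form (a *: u) (b *: u) = a * b^*%C * root_norm u.
Proof.
rewrite /root_form; case: cid2 => t Nt tx /=.
rewrite -[in RHS](coef_frameK Nt tx u) root_normZ !(coefZ Nt tx).
rewrite [(_ * coef t u)^*%C]rmorphM /=.
by rewrite sqr_normc; ring.
Qed.

Lemma root_form_linear x (w : N x) : scalar (fun v => root_form v w).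
Proof.
move=> a u v; rewrite /root_form; case: cid2 => t Nt tx /=.
by rewrite (coef_linear Nt tx) !mulrDl !mulrA.
Qed.

Lemma root_formvv x (v : N x) : root_form v v = root_norm v.
Proof.
by rewrite -[in LHS](scale1r v) root_formZ conjc1 !mul1r.
Qed.

Lemma root_form_conj x (v w : N x) : root_form w v = (root_form v w)^*%C.
Proof.
(* The last factor is real: its conjugate differs only by the sign of a zero imaginary part, which
   [oppr0] removes. *)
rewrite /root_form !rmorphM /= conjcK oppr0; congr (_ * _).
by rewrite mulrC.
Qed.

Lemma root_form_pos x (v : N x) : v != 0 -> 0 < root_form v v.
Proof. by rewrite root_formvv; exact: root_norm_gt0. Qed.

Lemma root_norm_smooth t : ltrivs (latlas N) t ->
  smooth_line M (tdom t) (fun x _ => root_norm (frame t x)).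
Proof.
move=> Nt; apply: smooth_over_sqrt; first exact: tdom_open.
  by move=> x _ tx; rewrite hform_re_gt0 // sqrt_map_eq0 (frame_neq0 Nt tx).
apply: (@hform_smooth_section _ _ _ L h (tdom t) (fun x => sqrt_map (frame t x))).
  exact: tdom_open.
by move=> t' Lt'; apply: sqrt_regular_frame => //; exact: smooth_line_id.
Qed.

Lemma root_form_smooth t (z w : R[i]) : ltrivs (latlas N) t ->
  smooth_fun (atlas M) (tdom t) (fun x => root_form (tinv t x z) (tinv t x w)).
Proof.
move=> Nt; apply/(smooth_fun_over (atlas M) (@ofpair R) (tdom t)).
apply: (smooth_over_congr (tdom_open t)
    (f := fun x _ => z * w^*%C * root_norm (frame t x))).
  by move=> x _ tx; rewrite !(tinv_frame Nt tx) root_formZ.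
apply: smooth_over_mul; first exact: tdom_open.
  exact: smooth_over_cst.
exact: root_norm_smooth.
Qed.

Definition root_metric : hermitian_metric N :=
  HermitianMetric root_form_linear root_form_conj root_form_pos root_form_smooth.

Lemma root_metric_unit x (v : N x) :
  root_metric x v v = 1 -> h x (sqrt_map v) (sqrt_map v) = 1.
Proof. by rewrite /= root_formvv -root_norm_sqr => ->; rewrite expr1n. Qed.

End RootMetric.

Definition forget_metric : functor (hermitian_sqrt_category h) (sqrt_category L) :=
  @Functor (hermitian_sqrt_category h) (sqrt_category L)
    (@herm_root _ _ _ _ _) (fun _ _ f => sval f) (fun _ => erefl)
    (fun _ _ _ _ _ => erefl).

Lemma hermitian_sqrt_equivalent :
  equivalent (hermitian_sqrt_category h) (sqrt_category L).
Proof.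
apply: (@equivalent_fully_faithful _ _ forget_metric) => [N N'|N N' f|N].
- by move=> [f hf] [g hg] /= fg; exact: eq_exist.
- by exists (exist _ f (herm_unitary f)).
- exists (HermitianRoot (@root_metric_unit N)); exact: isomorphic_refl.
Qed.

End ForgetMetric.

(** * Spin structures *)

Section CircleMaps.
Variables (R : realType) (n : nat) (M : manifold R n).
Implicit Types P Q : circle_bundle M.

Lemma cvalX (g : circle R) k : cval (g ^+ k)%g = cval g ^+ k.
Proof. by elim: k => [//|k IH]; rewrite expgS exprS cvalM IH. Qed.

Lemma circle_tinv P (t : ltriv (circle_fibre R) P) x (s : circle R) :
  ctriv P t -> tdom t x -> tinv t x s = cact (tinv t x (1%g : circle R)) s.
Proof.
move=> Pt tx; rewrite -[LHS](tfunK tx) -[RHS](tfunK tx) ctriv_equivariant // !tinvK //.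
by rewrite mul1g.
Qed.

Lemma smooth_circle_val (W : set M) : smooth_circle M W (fun _ s => cval s).
Proof.
move=> c _ k; apply: (Ck_sub (D' := setT)) => //.
have oT : open (setT : set ('rV[R]_n * R)) by exact: openT.
have [hc hs] := Ck_cos_sin R k.
have sub (f : R -> R) : Ck k setT f -> Ck k setT (fun p : 'rV[R]_n * R => f p.2).
  move=> hf; apply: (Ck_comp_scalar (D' := setT) (g := f) (f := snd)) => //.
  - exact: finite_basis_R.
  - exact: openT.
  - exact: Ck_snd.
by apply/(Ck_pair _ _ oT); split; exact: sub.
Qed.

(** The bridge between circle bundles and line bundles: their transition data are functions on the
    base, for which the parametrization of the fibre is immaterial. *)
Lemma smooth_circle_line (W : set M) (a : M -> R[i]) :
  smooth_circle M W (fun x _ => a x) <-> smooth_line M W (fun x _ => a x).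
Proof.
have hc := smooth_fun_over (atlas M) (@cis R) W a.
have hl := smooth_fun_over (atlas M) (@ofpair R) W a.
by split=> [/hc.2/hl.1|/hl.2/hc.1].
Qed.

(** The analogue for torsors of [line_map_homogP]: [k := 0] covers bundle maps, [k := 1] maps along
    the squaring Spin_2 -> SO(2). *)
Lemma circle_map_homog P Q k (f : forall x, P x -> Q x) :
  (forall x p g, f x (cact p g) = cact (f x p) (g ^+ k.+1)%g) ->
  (forall t t', ctriv P t -> ctriv Q t' -> smooth_line M (tdom t `&` tdom t')
     (fun x _ => cval (tfun t' (f x (tinv t x (1%g : circle R)))))) ->
  circle_map_smooth f.
Proof.
move=> ef sf t t' Pt Qt'.
have oW : open (tdom t `&` tdom t') by apply: openI; exact: tdom_open.
have h : smooth_circle M (tdom t `&` tdom t') (fun x (s : circle R) =>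
    cval (tfun t' (f x (tinv t x (1%g : circle R)))) * cval s ^+ k.+1).
  apply: regular_mul; first exact: oW.
    by apply/smooth_circle_line; exact: sf.
  by apply: regularX; [exact: oW|exact: smooth_circle_val].
apply: regular_congr h; first exact: oW.
move=> x s [tx t'x] /=.
by rewrite (circle_tinv s Pt tx) ef ctriv_equivariant // -cvalX -cvalM.
Qed.

Lemma circle_map_line P Q (f : forall x, P x -> Q x) t t' :
  circle_map_smooth f -> ctriv P t -> ctriv Q t' ->
  smooth_line M (tdom t `&` tdom t')
    (fun x _ => cval (tfun t' (f x (tinv t x (1%g : circle R))))).
Proof.
by move=> sf Pt Qt'; apply/smooth_circle_line; exact: regular_one (sf t t' Pt Qt').
Qed.

(** The fibres are torsors, so an equivariant map is bijective on each of them, and in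
    trivializations its inverse multiplies by the inverse function. *)
Lemma circle_iso_equivariant P Q (f : forall x, P x -> Q x) :
  (forall x p g, f x (cact p g) = cact (f x p) g) -> circle_map_smooth f ->
  circle_iso f.
Proof.
move=> ef sf; split=> //.
have surj x (q : Q x) : exists p, f x p = q.
  have [g ->] := cact_trans (f x (base_point P x)) q.
  by exists (cact (base_point P x) g); rewrite ef.
pose f' x q := projT1 (cid (surj x q)).
have f'K x : cancel (f' x) (f x) by move=> q; exact: projT2 (cid (surj x q)).
have fK x : cancel (f x) (f' x).
  move=> p; have [g E] := cact_trans p (f' x (f x p)).
  rewrite E; suff -> : g = 1%g by rewrite cact1.
  by apply: (@cact_free _ _ _ _ _ (f x p)); rewrite -ef -E f'K cact1.
have ef' x q g : f' x (cact q g) = cact (f' x q) g.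
  by apply: (can_inj (fK x)); rewrite ef !f'K.
exists f' => //; apply: (circle_map_homog (k := 0)) => [x q g|t t' Qt Pt'].
  by rewrite ef' expg1.
have h := circle_map_line sf Pt' Qt.
have oW : open (tdom t' `&` tdom t) by apply: openI; exact: tdom_open.
rewrite setIC.
apply: (smooth_over_congr oW (f := fun x _ =>
    (cval (tfun t (f x (tinv t' x (1%g : circle R)))))^-1)).
  move=> x _ [t'x tx]; set p := tinv t' x _.
  (* g carries f p to the frame of Q. It is thus inverse to the coordinate of f p, and it is also
     the coordinate of the preimage p g of that frame. *)
  have [g gE] := cact_trans (f x p) (tinv t x (1%g : circle R)).
  rewrite gE ef' fK ctriv_equivariant // /p tinvK // mul1g.
  have : tfun t (tinv t x (1%g : circle R)) = 1%g by exact: tinvK.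
  rewrite gE ctriv_equivariant // => /(congr1 (@cval R)).
  by rewrite cvalM cval1 => /(canRL (mulKf (cval_neq0 _))); rewrite mulr1.
by apply: smooth_overV => // x _ _; exact: cval_neq0.
Qed.

End CircleMaps.

(** * Points of P as unit vectors of the associated line *)

Section AssociatedMaps.
Variables (R : realType) (n : nat) (M : manifold R n) (P : circle_bundle M).

(** Together with [assoc_unit] this identifies P with the unit circle bundle of its associated line;
    equalities of points are proved below by passing to [p, 1]. *)
Lemma assoc_class_inj x (p q : P x) : assoc_class p 1 = assoc_class q 1 -> p = q.
Proof.
move=> /(congr1 (@assoc_coord _ _ _ P x)); rewrite !assoc_coordE !mulr1.
move=> /val_inj E.
by rewrite (translationP (base_point P x) p) E -translationP.
Qed.

Lemma assoc_class_scale x (p : P x) g :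
  assoc_class (cact p g) 1 = cval g *: assoc_class p 1.
Proof. by rewrite assoc_class_act -assoc_classZ. Qed.

Lemma assoc_class1 x (p : P x) z : assoc_class p z = z *: assoc_class p 1.
Proof. by rewrite -assoc_classZ mulr1. Qed.

Lemma assoc_class_neq0 x (p : P x) : assoc_class p 1 != 0.
Proof.
apply/eqP => /(congr1 (@assoc_coord _ _ _ P x)); rewrite assoc_coordE mulr1.
have -> : (0 : assoc_fibre P x) = assoc_class (base_point P x) 0 by [].
by rewrite assoc_classK; apply/eqP; exact: cval_neq0.
Qed.

Lemma assoc_unit x (w : assoc_fibre P x) : assoc_form w w = 1 ->
  exists p, w = assoc_class p 1.
Proof.
elim/assoc_ind: w => q z; rewrite assoc_formE -sqr_normc => z1.
have z2 : `|z| == 1 by rewrite -(eqrXn2 (n := 2)) // z1 expr1n.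
exists (cact q (Circle z2)).
by rewrite assoc_class_act mulr1.
Qed.

Section Lift.
Variables (x : M) (V : lmodType R[i]) (k : P x -> V).
Hypothesis kM : forall p g, k (cact p g) = cval g *: k p.

(** The universal property of P x_T C: an equivariant k extends to [p, z] |-> z k(p). By [kM] the
    base point does not matter. *)
Definition assoc_lift (u : assoc_fibre P x) : V :=
  assoc_coord u *: k (base_point P x).

Lemma assoc_liftE p z : assoc_lift (assoc_class p z) = z *: k p.
Proof.
rewrite /assoc_lift assoc_coordE [in RHS](translationP (base_point P x) p) kM.
by rewrite scalerA mulrC.
Qed.

Lemma assoc_lift_linear : linear assoc_lift.
Proof. by move=> a u v; rewrite /assoc_lift assoc_coord_linear scalerDl scalerA. Qed.

Lemma assoc_lift_eq0 u : (forall p, k p != 0) -> assoc_lift u = 0 -> u = 0.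
Proof.
elim/assoc_ind: u => p z k0; rewrite assoc_liftE => /eqP.
by rewrite scaler_eq0 (negbTE (k0 p)) orbF assoc_class1 => /eqP ->; rewrite scale0r.
Qed.

End Lift.

Lemma assoc_lift_smooth (N : line_bundle (smooth_line M)) (k : forall x, P x -> N x) :
  (forall x p g, k x (cact p g) = cval g *: k x p) ->
  (forall t t', ctriv P t -> ltrivs (latlas N) t' -> smooth_line M (tdom t `&` tdom t')
     (fun x _ => coef t' (k x (tinv t x (1%g : circle R))))) ->
  line_map_regular (fun x (u : assoc_line_bundle P x) => assoc_lift (k x) u).
Proof.
move=> kM sk; apply/(line_map_homogP (k := 0) (@smooth_line_id _ _ _)).
  by move=> x; exact: (linear_scale (N := assoc_line_bundle P) (assoc_lift_linear (k x))).
move=> _ t' [t [Pt ->]] Nt'.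
have oW : open (tdom t `&` tdom t') by apply: openI; exact: tdom_open.
apply: regular_congr (sk t t' Pt Nt') => // x s _.
by rewrite /frame /= /assoc_tinv assoc_liftE // scale1r.
Qed.

End AssociatedMaps.

(** * From spin structures to square roots *)

Section SpinRoots.
Variables (R : realType) (n : nat) (M : manifold R n) (Q : circle_bundle M).
Local Notation L := (assoc_line_bundle Q).

Section RootOfSpin.
Variable P : spin_structure Q.

Definition spin_root_map x (u : assoc_line_bundle P x) : L x :=
  assoc_class (spin_map (base_point P x)) (assoc_coord u ^+ 2).

(** Frees the map from the base point: replacing p by p g multiplies its image by g^2, which matches
    the square of the change of coordinate. *)
Lemma spin_root_mapE x (p : P x) z :
  spin_root_map (assoc_class p z) = assoc_class (spin_map p) (z ^+ 2).
Proof.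
rewrite /spin_root_map assoc_coordE [in RHS](translationP (base_point P x) p).
by rewrite spin_equivariant assoc_class_act cvalX exprMn.
Qed.

Lemma spin_root_mapZ x a (u : assoc_line_bundle P x) :
  spin_root_map (a *: u) = a ^+ 2 *: spin_root_map u.
Proof.
elim/assoc_ind: u => p z.
by rewrite -assoc_classZ !spin_root_mapE exprMn assoc_classZ.
Qed.

Lemma spin_root_regular : line_map_regular spin_root_map.
Proof.
apply/(line_map_homogP (k := 1) (@smooth_line_id _ _ _) spin_root_mapZ).
move=> _ _ [t [Pt ->]] [t' [Qt' ->]].
have oW : open (tdom t `&` tdom t') by apply: openI; exact: tdom_open.
have h := circle_map_line (@spin_smooth _ _ _ _ P) Pt Qt'.
apply: regular_congr h => // x s [tx t'x].
by rewrite /frame /coef /= /assoc_tinv spin_root_mapE assoc_tfunE // expr1n mulr1.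
Qed.

Lemma spin_root_surjective x (w : L x) : exists v, spin_root_map v = w.
Proof.
apply: (square_surjective (N := assoc_line_bundle P)); first exact: spin_root_mapZ.
exists (assoc_class (base_point P x) 1).
by rewrite spin_root_mapE expr1n assoc_class_neq0.
Qed.

Lemma spin_root_quadratic x : quadratic_map (@spin_root_map x).
Proof.
by apply: (square_quadratic (N := assoc_line_bundle P)); exact: spin_root_mapZ.
Qed.

Definition spin_root : square_root L :=
  SquareRoot spin_root_regular spin_root_surjective spin_root_quadratic.

End RootOfSpin.

Section RootOfHom.
Variables (P P' : spin_structure Q) (f : spin_hom P P').

Definition spin_root_fun x (u : spin_root P x) : spin_root P' x :=
  assoc_lift (fun p => assoc_class (sval f x p) 1) u.

Lemma spin_root_act x (p : P x) g :
  assoc_class (sval f x (cact p g)) 1 = cval g *: assoc_class (sval f x p) 1.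
Proof. by case: f => f0 [[ef _ _] _] /=; rewrite ef assoc_class_scale. Qed.

Lemma spin_root_funE x (p : P x) z :
  spin_root_fun (assoc_class p z) = assoc_class (sval f x p) z.
Proof.
by rewrite /spin_root_fun assoc_liftE -?assoc_class1 //; exact: spin_root_act.
Qed.

Lemma spin_root_hom_subproof : line_iso spin_root_fun /\
  forall x (u : spin_root P x), sqrt_map (spin_root_fun u) = sqrt_map u.
Proof.
split; last first.
  move=> x; elim/assoc_ind => p z; rewrite spin_root_funE.
  rewrite [LHS]spin_root_mapE [RHS]spin_root_mapE.
  by case: f => f0 [_ qf] /=; rewrite qf.
have act := spin_root_act.
apply: smooth_line_iso => [x||x v].
- exact: assoc_lift_linear.
- apply: assoc_lift_smooth => // t _ Pt [t' [Pt' ->]].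
  have oW : open (tdom t `&` tdom t') by apply: openI; exact: tdom_open.
  have sf : circle_map_smooth (sval f) by case: f => f0 [[]].
  apply: regular_congr (circle_map_line sf Pt Pt') => // x s [tx t'x].
  by rewrite /coef /= assoc_tfunE // mulr1.
- by apply: assoc_lift_eq0 => [p c|p]; [exact: act|exact: assoc_class_neq0].
Qed.

Definition spin_root_hom : sqrt_hom (spin_root P) (spin_root P') :=
  exist _ spin_root_fun spin_root_hom_subproof.

End RootOfHom.

Fact spin_root_id (P : spin_structure Q) :
  spin_root_hom (spin_id P) = sqrt_id (spin_root P).
Proof. by apply: sqrt_hom_eq => x; elim/assoc_ind => p z; exact: spin_root_funE. Qed.

Fact spin_root_comp (P P' P'' : spin_structure Q) (f : spin_hom P P')
    (g : spin_hom P' P'') :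
  spin_root_hom (spin_comp f g) = sqrt_comp (spin_root_hom f) (spin_root_hom g).
Proof.
apply: sqrt_hom_eq => x; elim/assoc_ind => p z.
by rewrite [LHS]spin_root_funE /= !spin_root_funE.
Qed.

Definition spin_root_functor : functor (spin_category Q) (sqrt_category L) :=
  @Functor (spin_category Q) (sqrt_category L) spin_root spin_root_hom
    spin_root_id spin_root_comp.

Lemma spin_root_hom_inj (P P' : spin_structure Q) :
  injective (@spin_root_hom P P').
Proof.
move=> [f hf] [g hg] fg; apply: eq_exist.
apply: functional_extensionality_dep => x; apply/funext => p.
apply: assoc_class_inj; have := congr1 (fun k => sval k x (assoc_class p 1)) fg.
by rewrite /= !spin_root_funE.
Qed.

(** The relation |q u|^2 = |u|^4 again; it makes a morphism of roots preserve unit vectors, and so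
    act on the points of the spin structures. *)
Lemma spin_root_form (P : spin_structure Q) x (u : spin_root P x) :
  assoc_form (sqrt_map u) (sqrt_map u) = assoc_form u u ^+ 2.
Proof.
elim/assoc_ind: u => p z; rewrite [sqrt_map _]spin_root_mapE !assoc_formE.
by rewrite rmorphXn exprMn.
Qed.

Section HomOfRoot.
Variables (P P' : spin_structure Q) (g : sqrt_hom (spin_root P) (spin_root P')).

Lemma root_hom_point x (p : P x) :
  exists p' : P' x, sval g x (assoc_class p 1) = assoc_class p' 1.
Proof.
apply: assoc_unit; apply/eqP.
rewrite -(eqrXn2 (n := 2)) ?ler01 //; last exact: (hform_ge0 (assoc_metric P')).
have [_ qg] := svalP g.
rewrite -(spin_root_form (P := P')) qg spin_root_form assoc_formE.
by rewrite conjc1 mulr1 !expr1n.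
Qed.

Definition root_hom_fun x (p : P x) : P' x := projT1 (cid (root_hom_point p)).

Lemma root_hom_funE x (p : P x) :
  sval g x (assoc_class p 1) = assoc_class (root_hom_fun p) 1.
Proof. exact: projT2 (cid (root_hom_point p)). Qed.

Lemma root_hom_spin : circle_iso root_hom_fun /\
  forall x (p : P x), spin_map (root_hom_fun p) = spin_map p.
Proof.
have [[lg sg _] qg] := svalP g.
have gZ x a u : sval g x (a *: u) = a *: sval g x u.
  by rewrite (linear_scale (lg x)) expr1.
have act x (p : P x) c : root_hom_fun (cact p c) = cact (root_hom_fun p) c.
  apply: assoc_class_inj.
  by rewrite -root_hom_funE !assoc_class_scale gZ root_hom_funE.
split; last first.
  move=> x p; apply: assoc_class_inj.
  have := qg x (assoc_class p 1); rewrite root_hom_funE.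
  by rewrite [LHS]spin_root_mapE [RHS]spin_root_mapE !expr1n.
apply: circle_iso_equivariant => //.
apply: (circle_map_homog (k := 0)) => [x p c|t t' Pt Pt']; first by rewrite expg1.
have oW : open (tdom t `&` tdom t') by apply: openI; exact: tdom_open.
have Ht : assoc_ltrivs (assoc_triv Pt) by exists t, Pt.
have Ht' : assoc_ltrivs (assoc_triv Pt') by exists t', Pt'.
apply: regular_congr (regular_one (sg _ _ Ht Ht')) => // x s [tx t'x] /=.
by rewrite /assoc_tinv root_hom_funE assoc_tfunE // mulr1.
Qed.

End HomOfRoot.

End SpinRoots.

Section RootIsomorphisms.
Variables (R : realType) (n : nat) (M : manifold R n) (O : regularity M (line_fibre R)).
Variable L : line_bundle O.

(** Morphisms of roots are invertible by definition, so essential surjectivity only asks for one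
    morphism. *)
Lemma sqrt_hom_isomorphic (N N' : square_root L) (f : sqrt_hom N N') :
  isomorphic (N : sqrt_category L) (N' : sqrt_category L).
Proof.
case: f => f [lf qf]; have [lin sf [f' ff' sf']] := lf.
have lf' : line_iso f'.
  split=> [x a u v||]; last by exists f => // x; have [] := ff' x; split.
    by apply: (can_inj (ff' x).1); rewrite lin !(ff' x).2.
  exact: sf'.
have qf' x (v : N' x) : sqrt_map (f' x v) = sqrt_map v.
  by rewrite -qf (ff' x).2.
exists (exist _ f (conj lf qf)), (exist _ f' (conj lf' qf')).
by split; apply: sqrt_hom_eq => x v /=; rewrite ?(ff' x).1 ?(ff' x).2.
Qed.

End RootIsomorphisms.

(** * The unit circle bundle of a root *)

Section UnitCircle.
Variables (R : realType) (n : nat) (M : manifold R n) (Q : circle_bundle M).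
Local Notation L := (assoc_line_bundle Q).
Variable N : square_root L.
Local Notation norm := (@root_norm _ _ _ _ (assoc_metric Q) N _).
Local Notation U := (fun x => {v : N x | norm v == 1}).
Local Notation ltrivN := (ltriv (line_fibre R) (fun y => N y)).

Fact unit_act_subproof x (v : U x) (g : circle R) : norm (cval g *: val v) == 1.
Proof. by rewrite root_normZ (eqP (circleP g)) expr1n mul1r (valP v). Qed.

Definition unit_act x (v : U x) (g : circle R) : U x :=
  exist (fun w => norm w == 1) _ (unit_act_subproof v g).

Fact unit_act1 x (v : U x) : unit_act v 1%g = v.
Proof. by apply: val_inj; rewrite /= scale1r. Qed.

Fact unit_actM x (v : U x) g h : unit_act v (g * h)%g = unit_act (unit_act v g) h.
Proof. by apply: val_inj; rewrite /= scalerA mulrC. Qed.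

(** [norm] is a squared length, hence the further root: this is |e|, and e / |e| is the unit frame
    used below. *)
Definition frame_length (t : ltrivN) x : R[i] :=
  (Num.sqrt (complex.Re (norm (frame t x))))%:C%C.

Section FrameLength.
Variables (t : ltrivN) (Nt : ltrivs (latlas N) t).

Lemma frame_length_gt0 x : tdom t x -> 0 < frame_length t x.
Proof.
move=> tx; rewrite ltcR sqrtr_gt0 -ltcR.
by have := root_norm_gt0 (assoc_metric Q) (frame_neq0 Nt tx).
Qed.

Lemma frame_length_sqr x : tdom t x -> frame_length t x ^+ 2 = norm (frame t x).
Proof.
move=> tx; rewrite -rmorphXn /= sqr_sqrtr ?sqrtr_ge0 //.
Qed.

Lemma frame_length_smooth :
  smooth_line M (tdom t) (fun x _ => frame_length t x).
Proof.
apply: smooth_over_sqrt; first exact: tdom_open.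
  move=> x _ tx; rewrite -ltcR.
  exact: (root_norm_gt0 (assoc_metric Q) (frame_neq0 Nt tx)).
exact: root_norm_smooth.
Qed.

Lemma norm_coef x (v : N x) : tdom t x ->
  norm v = `|coef t v * frame_length t x| ^+ 2.
Proof.
move=> tx; rewrite -[in LHS](coef_frameK Nt tx v) root_normZ -frame_length_sqr //.
by rewrite normrM exprMn [`|frame_length _ _|]ger0_norm // ltW // frame_length_gt0.
Qed.

Lemma norm_eq1 x (v : N x) : tdom t x ->
  (norm v == 1) = (`|coef t v * frame_length t x| == 1).
Proof.
move=> tx; rewrite (norm_coef v tx).
by rewrite -[RHS](eqrXn2 (n := 2)) // ?normr_ge0 ?ler01 // expr1n.
Qed.

Lemma unit_frame_subproof x (g : circle R) : tdom t x ->
  norm ((cval g / frame_length t x) *: frame t x) == 1.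
Proof.
move=> tx; rewrite norm_eq1 // (coefZ Nt tx) (coef_frame tx) mulr1.
by rewrite divfK ?(eqP (circleP g)) // gt_eqF // frame_length_gt0.
Qed.

End FrameLength.

Lemma unit_nonempty x : exists v : N x, norm v == 1.
Proof.
have [t Nt tx] := ltriv_cover (latlas N) x.
by exists ((cval 1%g / frame_length t x) *: frame t x); exact: unit_frame_subproof.
Qed.

(** Trivializations are total functions, while e / |e| is known to have length 1 only over [tdom t];
    elsewhere this value is returned. *)
Definition unit_default x : U x :=
  exist (fun w => norm w == 1) (projT1 (cid (unit_nonempty x)))
    (projT2 (cid (unit_nonempty x))).

Definition unit_tfun (t : ltrivN) x (v : U x) : circle R :=
  insubd (circle1 R) (coef t (val v) * frame_length t x).

Definition unit_tinv (t : ltrivN) x (g : circle R) : U x :=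
  insubd (unit_default x) ((cval g / frame_length t x) *: frame t x).

Section UnitTriv.
Variables (t : ltrivN) (Nt : ltrivs (latlas N) t).

Lemma unit_tfunE x (v : U x) : tdom t x ->
  cval (unit_tfun t v) = coef t (val v) * frame_length t x.
Proof.
move=> tx; apply: (insubdK (circle1 R)).
by rewrite unfold_in -norm_eq1 //; exact: (valP v).
Qed.

Lemma unit_tinvE x g : tdom t x ->
  val (unit_tinv t x g) = (cval g / frame_length t x) *: frame t x.
Proof.
move=> tx; apply: (insubdK (unit_default x)); rewrite unfold_in.
exact: unit_frame_subproof.
Qed.

Lemma unit_tfunK x : tdom t x -> cancel (@unit_tfun t x) (unit_tinv t x).
Proof.
move=> tx v; apply: val_inj; rewrite unit_tinvE // unit_tfunE // mulfK.
  exact: coef_frameK.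
by rewrite gt_eqF // frame_length_gt0.
Qed.

Lemma unit_tinvK x : tdom t x -> cancel (unit_tinv t x) (@unit_tfun t x).
Proof.
move=> tx g; apply: val_inj; rewrite /= unit_tfunE // unit_tinvE //.
rewrite (coefZ Nt tx) (coef_frame tx) mulr1 divfK //.
by rewrite gt_eqF // frame_length_gt0.
Qed.

Definition unit_triv : ltriv (circle_fibre R) U :=
  Ltriv (F := circle_fibre R) (tdom_open t) unit_tfunK unit_tinvK.

End UnitTriv.

Definition unit_ltrivs : set (ltriv (circle_fibre R) U) :=
  [set s | exists t (Nt : ltrivs (latlas N) t), s = unit_triv Nt].

Fact unit_cover x : exists2 s, unit_ltrivs s & tdom s x.
Proof.
by have [t Nt tx] := ltriv_cover (latlas N) x; exists (unit_triv Nt) => //; exists t, Nt.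
Qed.

Fact unit_equivariant s x (v : U x) g : unit_ltrivs s -> tdom s x ->
  tfun s (unit_act v g) = (tfun s v * g)%g.
Proof.
move=> [t [Nt ->]] /= tx; apply: val_inj => /=.
by rewrite !unit_tfunE //= (coefZ Nt tx) [RHS]mulrC mulrA.
Qed.

Lemma inv_frame_length_smooth t : ltrivs (latlas N) t ->
  smooth_line M (tdom t) (fun x _ => (frame_length t x)^-1).
Proof.
move=> Nt; apply: smooth_overV; first exact: tdom_open.
  by move=> x _ tx; rewrite gt_eqF // frame_length_gt0.
exact: frame_length_smooth.
Qed.

Fact unit_smooth :
  regular_map (smooth_circle M) unit_ltrivs unit_ltrivs (fun x v => v).
Proof.
move=> _ _ [t [Nt ->]] [t' [Nt' ->]] /=.
have oW : open (tdom t `&` tdom t') by apply: openI; exact: tdom_open.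
(* Passing from the unit frame e / |e| to e' / |e'| multiplies the transition function of e and e'
   by |e'| / |e|. *)
have h : smooth_circle M (tdom t `&` tdom t') (fun x (s : circle R) =>
    coef t' (frame t x) * (frame_length t x)^-1 * frame_length t' x * cval s).
  apply: regular_mul; [exact: oW| |exact: smooth_circle_val].
  apply/smooth_circle_line; apply: regular_mul; first exact: oW.
    apply: regular_mul; first exact: oW.
      exact: regular_one (ltriv_regular Nt Nt').
    apply: regular_sub (inv_frame_length_smooth Nt); first exact: oW.
      exact: tdom_open.
    by move=> y [].
  apply: regular_sub (frame_length_smooth Nt'); first exact: oW.
    exact: tdom_open.
  by move=> y [].
apply: regular_congr h; first exact: oW.
move=> x s [tx t'x] /=; rewrite unit_tfunE // unit_tinvE // (coefZ Nt' t'x).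
by ring.
Qed.

Definition unit_bundle : circle_bundle M :=
  CircleBundle unit_act1 unit_actM unit_cover unit_equivariant unit_smooth.

Lemma unit_point x (v : U x) : exists p : Q x, sqrt_map (val v) = assoc_class p 1.
Proof.
apply: assoc_unit; have := root_norm_sqr (assoc_metric Q) (val v).
by rewrite (eqP (valP v)) expr1n => /esym.
Qed.

Definition unit_map x (v : unit_bundle x) : Q x := projT1 (cid (unit_point v)).

Lemma unit_mapE x (v : U x) : sqrt_map (val v) = assoc_class (unit_map v) 1.
Proof. exact: projT2 (cid (unit_point v)). Qed.

Lemma unit_map_equivariant x (v : unit_bundle x) g :
  unit_map (cact v g) = cact (unit_map v) (g ^+ 2)%g.
Proof.
apply: assoc_class_inj.
by rewrite -unit_mapE /= sqrt_mapZ unit_mapE assoc_class_scale cvalX.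
Qed.

Lemma unit_map_smooth : circle_map_smooth unit_map.
Proof.
apply: (circle_map_homog (k := 1)); first exact: unit_map_equivariant.
move=> _ t' [t [Nt ->]] Qt' /=.
have oW : open (tdom t `&` tdom t') by apply: openI; exact: tdom_open.
have Lt' : assoc_ltrivs (assoc_triv Qt') by exists t', Qt'.
(* The image of the unit frame e / |e| under the square map is |e|^-2 q e. *)
have h : smooth_line M (tdom t `&` tdom t') (fun x _ => (frame_length t x)^-1 ^+ 2 *
    coef (N := L) (assoc_triv Qt') (sqrt_map (frame t x))).
  apply: regular_mul; first exact: oW.
    apply: regularX; first exact: oW.
    apply: regular_sub (inv_frame_length_smooth Nt); first exact: oW.
      exact: tdom_open.
    by move=> y [].
  exact: (sqrt_regular_frame (@smooth_line_id _ _ _) Nt Lt').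
apply: regular_congr h; first exact: oW.
move=> x s [tx t'x].
rewrite -(coefZ (N := L) (t := assoc_triv Qt') Lt' t'x) -sqrt_mapZ.
have -> : (frame_length t x)^-1 *: frame t x = val (unit_tinv t x 1%g).
  by rewrite unit_tinvE // cval1 mul1r.
by rewrite unit_mapE /coef /= assoc_tfunE // mulr1.
Qed.

Definition unit_spin : spin_structure Q :=
  SpinStructure unit_map_smooth unit_map_equivariant.

Definition unit_root_fun x (u : spin_root unit_spin x) : N x :=
  assoc_lift (fun v : unit_spin x => val (v : U x)) u.

Lemma unit_root_hom_subproof : line_iso unit_root_fun /\
  forall x (u : spin_root unit_spin x), sqrt_map (unit_root_fun u) = sqrt_map u.
Proof.
have kM x (v : unit_spin x) g : val (cact v g : U x) = cval g *: val (v : U x) by [].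
split.
  apply: smooth_line_iso => [x||x v].
  - exact: assoc_lift_linear.
  - apply: assoc_lift_smooth => // _ t' [t [Nt ->]] Nt'.
    have oW : open (tdom t `&` tdom t') by apply: openI; exact: tdom_open.
    have h : smooth_line M (tdom t `&` tdom t')
        (fun x _ => (frame_length t x)^-1 * coef t' (frame t x)).
      apply: regular_mul; first exact: oW.
        apply: regular_sub (inv_frame_length_smooth Nt); first exact: oW.
          exact: tdom_open.
        by move=> y [].
      exact: regular_one (ltriv_regular Nt Nt').
    apply: regular_congr h; first exact: oW.
    move=> x s [tx t'x]; rewrite -(coefZ Nt' t'x) /=.
    by rewrite unit_tinvE // cval1 mul1r.
  - apply: (assoc_lift_eq0 (kM x)) => p; apply/eqP => p0.
    have := valP (p : U x); rewrite p0 /root_norm.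
    have /eqP -> : sqrt_map (0 : N x) == 0 by rewrite sqrt_map_eq0.
    by rewrite hform0 /= sqrtr0 eq_sym oner_eq0.
move=> x; elim/assoc_ind => p z.
rewrite [RHS]spin_root_mapE /unit_root_fun (assoc_liftE (kM x)).
by rewrite sqrt_mapZ (unit_mapE p) -assoc_class1.
Qed.

Definition unit_root_hom : sqrt_hom (spin_root unit_spin) N :=
  exist _ unit_root_fun unit_root_hom_subproof.

End UnitCircle.

Lemma spin_sqrt_equivalent (R : realType) (n : nat) (M : manifold R n)
    (Q : circle_bundle M) :
  equivalent (spin_category Q) (sqrt_category (assoc_line_bundle Q)).
Proof.
apply: (@equivalent_fully_faithful _ _ (spin_root_functor Q)) => [P P'|P P' g|N].
- exact: spin_root_hom_inj.
- exists (exist _ (root_hom_fun g) (root_hom_spin g)); apply: sqrt_hom_eq => x.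
  have [[lg _ _] _] := svalP g.
  elim/assoc_ind => p z; rewrite /= spin_root_funE /= assoc_class1 -root_hom_funE.
  by rewrite [in RHS]assoc_class1 (linear_scale (lg x)) expr1.
- exists (unit_spin N); exact: sqrt_hom_isomorphic (unit_root_hom N).
Qed.

(** * Holomorphic square roots *)

Section ComplexDerivative.
Variables (R : realType) (V : normedModType R).
Implicit Types F G : V -> R[i].

(** The real directional derivative packed into one complex number, so that the Leibniz rule holds
    in [R[i]] and the Cauchy-Riemann equations say that Jv in place of v multiplies it by i. *)
Definition cderive F x v : R[i] := ofpair ('D_v (fun p => reim (F p)) x).

Lemma cderiveM F G x v : differentiable (fun p => reim (F p)) x ->
  differentiable (fun p => reim (G p)) x ->
  differentiable (fun p => reim (F p * G p)) x ->
  cderive (fun p => F p * G p) x v = cderive F x v * G x + F x * cderive G x v.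
Proof.
move=> dF dG dFG; rewrite /cderive.
rewrite !(derive_pair _ dFG) !(derive_pair _ dF) !(derive_pair _ dG).
set f1 := fst \o (fun p => reim (F p)); set f2 := snd \o (fun p => reim (F p)).
set g1 := fst \o (fun p => reim (G p)); set g2 := snd \o (fun p => reim (G p)).
have -> : fst \o (fun p => reim (F p * G p)) = f1 * g1 - f2 * g2.
  apply/funext=> p; rewrite !fctE /f1 /f2 /g1 /g2 /=.
  by case: (F p) (G p) => ? ? [].
have -> : snd \o (fun p => reim (F p * G p)) = f1 * g2 + f2 * g1.
  apply/funext=> p; rewrite !fctE /f1 /f2 /g1 /g2 /=.
  by case: (F p) (G p) => ? ? [].
have d1 : derivable f1 x v.
  by apply: diff_derivable; apply: differentiable_comp dF (@fst_diff _ _ _ _).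
have d2 : derivable f2 x v.
  by apply: diff_derivable; apply: differentiable_comp dF (@snd_diff _ _ _ _).
have d3 : derivable g1 x v.
  by apply: diff_derivable; apply: differentiable_comp dG (@fst_diff _ _ _ _).
have d4 : derivable g2 x v.
  by apply: diff_derivable; apply: differentiable_comp dG (@snd_diff _ _ _ _).
have dM (a b : V -> R) : derivable a x v -> derivable b x v -> derivable (a * b) x v.
  exact: (@derivableM R V a b x v).
have DM (a b : V -> R) : derivable a x v -> derivable b x v ->
    'D_v (a * b) x = a x *: 'D_v b x + b x *: 'D_v a x.
  exact: (@deriveM R V a b x v).
have d13 := dM _ _ d1 d3; have d24 := dM _ _ d2 d4.
have d14 := dM _ _ d1 d4; have d23 := dM _ _ d2 d3.
rewrite (deriveB d13 d24) (deriveD d14 d23) !DM //.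
have -> : F x = (f1 x +i* f2 x)%C by rewrite /f1 /f2 /=; case: (F x).
have -> : G x = (g1 x +i* g2 x)%C by rewrite /g1 /g2 /=; case: (G x).
move: (f1 x) (f2 x) (g1 x) (g2 x) ('D_v f1 x) ('D_v f2 x) => a1 a2 b1 b2 a1' a2'.
move: ('D_v g1 x) ('D_v g2 x) => b1' b2'.
rewrite /ofpair /= /GRing.scale /=.
move: {-}R a1 a2 b1 b2 a1' a2' b1' b2' => K *.
by apply/eqP; rewrite eq_complex /=; apply/andP; split; apply/eqP; ring.
Qed.

Lemma ofpairJ (p : R * R) : ofpair (Jpair p) = 'i%C * ofpair p.
Proof.
case: p => a b; rewrite /ofpair /Jpair /=.
by apply/eqP; rewrite eq_complex /=; apply/andP; split; apply/eqP; ring.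
Qed.

Lemma ofpair_inj : injective (@ofpair R).
Proof. by move=> [a b] [c d] [-> ->]. Qed.

Lemma cderive_Jpair F x v w : cderive F x v = 'i%C * cderive F x w <->
  'D_v (fun p => reim (F p)) x = Jpair ('D_w (fun p => reim (F p)) x).
Proof. by rewrite /cderive -ofpairJ; split=> [/ofpair_inj|->]. Qed.

End ComplexDerivative.

(** * Holomorphic functions among the smooth ones *)

Section HolomorphicFunctions.
Variables (R : realType) (n : nat) (M : manifold R n) (m : nat).
Variable J : complex_structure M m.
Local Notation E := ('rV[R]_m * 'rV[R]_m)%type.

Lemma holomorphic_line_id (W : set M) : holomorphic_line J W (fun _ s => s).
Proof.
move=> c _.
have -> : (fun p : E * (R * R) => reim (ofpair p.2)) = snd.
  by apply/funext => -[y [a b]].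
split=> [k|x v _]; first exact: Ck_snd.
have D w : 'D_w (snd : E * (R * R) -> R * R) x = w.2.
  have /= -> := @derive_affine _ _ _ _ (snd : E * (R * R) -> R * R)
      snd (fun _ _ _ => erefl) id x w.
  exact: derive_id.
by rewrite !D.
Qed.

Lemma smooth_of_holomorphic W f : open W ->
  holomorphic_line J W f -> smooth_line M W f.
Proof.
move=> oW hf; apply: (@smooth_over_change _ _ _ _ (catlas J)).
- exact: finite_basis_prod (finite_basis_rV _ _) (finite_basis_rV _ _).
- exact: finite_basis_prod (finite_basis_R _) (finite_basis_R _).
- exact: oW.
- exact: catlas_cover.
- by move=> c c' Jc Mc'; exact: (catlas_compat Jc Mc').2.
- exact: holomorphic_smooth.
Qed.

Lemma smooth_in_complex_charts W f : open W ->
  smooth_line M W f -> smooth_over (catlas J) (@ofpair R) W f.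
Proof.
move=> oW hf; apply: (@smooth_over_change _ _ _ _ (atlas M)).
- exact: finite_basis_rV.
- exact: finite_basis_prod (finite_basis_R _) (finite_basis_R _).
- exact: oW.
- exact: atlas_cover.
- by move=> c c' Mc Jc'; exact: (catlas_compat Jc' Mc).1.
- exact: hf.
Qed.

(* differentiating g = f^2 k gives dg = 2 f k df + f^2 dk *)
Lemma holomorphic_sqrt W f g k : open W -> smooth_line M W f ->
  holomorphic_line J W g -> holomorphic_line J W k ->
  (forall x s, W x -> g x s = f x s * f x s * k x s) ->
  (forall x s, W x -> f x s * k x s != 0) -> holomorphic_line J W f.
Proof.
move=> oW sf hg hk E0 fk0; rewrite -[regular _ _ _]/(holomorphic_over J W f) => c Jc.
have sf' := smooth_in_complex_charts oW sf.
split=> [|p v Dp]; first exact: sf' c Jc.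
pose rd (f : M -> R[i] -> R[i]) (p : E * (R * R)) := f (cinv c p.1) (ofpair p.2).
have oD : open (fibred_dom c W : set (E * (R * R))) by exact: fibred_dom_open.
have sk : smooth_over (catlas J) (@ofpair R) W k by exact: holomorphic_smooth.
have sff := smooth_over_mul oW sf' sf'.
have sffk := smooth_over_mul oW sff sk.
have df : differentiable (fun p => reim (rd f p)) p by exact: (sf' c Jc 1%N).1 p Dp.
have dk : differentiable (fun p => reim (rd k p)) p by exact: (sk c Jc 1%N).1 p Dp.
have dff : differentiable (fun p => reim (rd f p * rd f p)) p.
  exact: (sff c Jc 1%N).1 p Dp.
have dffk : differentiable (fun p => reim (rd f p * rd f p * rd k p)) p.
  exact: (sffk c Jc 1%N).1 p Dp.
have Dg w : cderive (rd g) p w = cderive (fun p => rd f p * rd f p * rd k p) p w.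
  congr ofpair; apply: near_eq_derive.
  have : open_nbhs p (fibred_dom c W : set (E * (R * R))) by split.
  by move=> /open_nbhs_nbhs; apply: filterS => q [_ Wq]; rewrite /rd E0.
have G w : cderive (rd g) p w =
    2 * (rd f p * rd k p) * cderive (rd f) p w + rd f p * rd f p * cderive (rd k) p w.
  rewrite Dg cderiveM // cderiveM //.
  move: (rd f p) (rd k p) (cderive (rd f) p w) (cderive (rd k) p w).
  by move: {-}R[i] => K *; ring.
have cg : cderive (rd g) p (Jprod v) = 'i%C * cderive (rd g) p v.
  by apply/cderive_Jpair; have [_] := hg c Jc; apply.
have ck : cderive (rd k) p (Jprod v) = 'i%C * cderive (rd k) p v.
  by apply/cderive_Jpair; have [_] := hk c Jc; apply.
have : cderive (rd f) p (Jprod v) = 'i%C * cderive (rd f) p v.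
  have nz : 2 * (rd f p * rd k p) != 0.
    by rewrite mulf_neq0 ?pnatr_eq0 // fk0 //; case: Dp.
  apply: (mulfI nz); apply: (addIr (rd f p * rd f p * cderive (rd k) p (Jprod v))).
  rewrite -G cg ck G.
  move: 'i%C (rd f p) (rd k p) (cderive (rd f) p v) (cderive (rd k) p v).
  by move: {-}R[i] => K *; ring.
by move=> /cderive_Jpair.
Qed.

End HolomorphicFunctions.

(** * Forgetting and recovering the holomorphic structure *)

Section UnderlyingSmooth.
Variables (R : realType) (n : nat) (M : manifold R n) (m : nat).
Variable J : complex_structure M m.

Lemma smooth_map_of_holomorphic (N N' : M -> Type)
    (A : set (ltriv (line_fibre R) N)) (A' : set (ltriv (line_fibre R) N'))
    (f : forall x, N x -> N' x) :
  regular_map (holomorphic_line J) A A' f -> regular_map (smooth_line M) A A' f.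
Proof.
move=> hf t t' At At'; apply: smooth_of_holomorphic (hf t t' At At').
by apply: openI; exact: tdom_open.
Qed.

(** Fibres and trivializations are kept, so the forgetful functor leaves fibrewise maps unchanged
    and its faithfulness is immediate. *)
Definition smooth_bundle (N : line_bundle (holomorphic_line J)) :
    line_bundle (smooth_line M) :=
  LineBundle (LineAtlas (@ltriv_cover _ _ _ _ _ (latlas N))
    (@ltriv_linear _ _ _ _ _ (latlas N))
    (smooth_map_of_holomorphic (@ltriv_regular _ _ _ _ _ (latlas N)))).

Lemma smooth_line_iso_of_holomorphic (N N' : line_bundle (holomorphic_line J))
    (f : forall x, N x -> N' x) :
  line_iso f -> @line_iso _ _ _ _ (smooth_bundle N) (smooth_bundle N') f.
Proof.
move=> [lf sf [f' ff' sf']]; split=> //; first exact: smooth_map_of_holomorphic.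
by exists f' => //; exact: smooth_map_of_holomorphic.
Qed.

Variables (L : line_bundle (smooth_line M)) (H : holomorphic_structure J L).
Local Notation LH := (holomorphic_bundle H).

Section Root.
Variable N : square_root LH.

(** L carries two atlases. The square map is smooth into the holomorphic one, and [hatlas_compat]
    passes to the smooth one through the identity of L. *)
Lemma smooth_root_regular :
  @line_map_regular _ _ _ _ (smooth_bundle N) L (fun x v => sqrt_map v).
Proof.
have h1 : @line_map_regular _ _ _ _ (smooth_bundle N) (smooth_bundle LH)
    (fun x v => sqrt_map v).
  exact: smooth_map_of_holomorphic (@sqrt_regular _ _ _ _ _ N).
have h2 : @line_map_regular _ _ _ _ (smooth_bundle LH) L (fun x v => v).
  exact: (hatlas_compat H).1.
exact: (line_map_comp (N' := smooth_bundle LH) _ h1 h2).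
Qed.

Definition smooth_root : square_root L :=
  @SquareRoot _ _ _ _ L (smooth_bundle N) (fun x v => sqrt_map v)
    smooth_root_regular (@sqrt_surjective _ _ _ _ _ N) (@sqrt_quadratic _ _ _ _ _ N).

End Root.

Definition smooth_root_hom (N N' : square_root LH) (f : sqrt_hom N N') :
    sqrt_hom (smooth_root N) (smooth_root N') :=
  exist _ (sval f) (conj (smooth_line_iso_of_holomorphic (svalP f).1) (svalP f).2).

Fact smooth_root_id (N : square_root LH) :
  smooth_root_hom (sqrt_id N) = sqrt_id (smooth_root N).
Proof. exact: sqrt_hom_eq. Qed.

Fact smooth_root_comp (N N' N'' : square_root LH) (f : sqrt_hom N N')
    (g : sqrt_hom N' N'') :
  smooth_root_hom (sqrt_comp f g) = sqrt_comp (smooth_root_hom f) (smooth_root_hom g).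
Proof. exact: sqrt_hom_eq. Qed.

Definition smooth_root_functor : functor (sqrt_category LH) (sqrt_category L) :=
  @Functor (sqrt_category LH) (sqrt_category L) smooth_root smooth_root_hom
    smooth_root_id smooth_root_comp.

(** Serves both for coefficients of morphisms and for transition functions of the new atlas. In a
    holomorphic frame of L the coordinates of v and w satisfy the equation of [holomorphic_sqrt]. *)
Lemma holomorphic_ratio W (a : M -> R[i]) (v w : forall x, L x) : open W ->
  smooth_line M W (fun x _ => a x) -> (forall x, W x -> a x != 0) ->
  (forall x, W x -> v x = a x ^+ 2 *: w x) -> (forall x, W x -> w x != 0) ->
  (forall s, ltrivs (hatlas H) s ->
     holomorphic_line J (W `&` tdom s) (fun x _ => coef (N := LH) s (v x))) ->
  (forall s, ltrivs (hatlas H) s ->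
     holomorphic_line J (W `&` tdom s) (fun x _ => coef (N := LH) s (w x))) ->
  holomorphic_line J W (fun x _ => a x).
Proof.
move=> oW sa a0 vw w0 hv hw.
apply: (regular_local (r := holomorphic_line J)) => // x Wx.
have [s Hs sx] := ltriv_cover (hatlas H) x.
have oWs : open (W `&` tdom s) by apply: openI => //; exact: tdom_open.
exists (W `&` tdom s), (fun x _ => a x); split=> //.
apply: (holomorphic_sqrt oWs _ (hv s Hs) (hw s Hs)).
- by apply: regular_sub sa => // y [].
- move=> y _ [Wy sy]; rewrite vw //.
  by rewrite (coefZ (N := LH) Hs sy) expr2.
- move=> y _ [Wy sy]; rewrite mulf_neq0 ?a0 //.
  by rewrite (coef_eq0 (N := LH) Hs sy) w0.
Qed.

(** Concludes for f alone; its inverse satisfies the same hypotheses and is treated by a second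
    application. *)
Lemma smooth_root_hom_holomorphic (N N' : square_root LH)
    (f : forall x, N x -> N' x) :
  @line_iso _ _ _ _ (smooth_bundle N) (smooth_bundle N') f ->
  (forall x (v : N x), sqrt_map (f x v) = sqrt_map v) -> line_map_regular f.
Proof.
move=> [lf sf [f' ff' _]] qf.
have fZ x a (v : N x) : f x (a *: v) = a *: f x v.
  by rewrite (linear_scale (lf x)) expr1.
apply/(line_map_homogP (k := 0) (@holomorphic_line_id _ _ _ _ J)).
  by move=> x a v; rewrite fZ expr1.
move=> t t' Nt Nt'.
have oW : open (tdom t `&` tdom t') by apply: openI; exact: tdom_open.
have fE x : (tdom t `&` tdom t') x ->
    f x (frame t x) = coef t' (f x (frame t x)) *: frame t' x.
  by move=> [tx t'x]; rewrite (coef_frameK Nt' t'x).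
have f0 x : (tdom t `&` tdom t') x -> f x (frame t x) != 0.
  move=> [tx _]; apply: contra (frame_neq0 Nt tx) => /eqP h.
  rewrite -(inj_eq (can_inj (ff' x).1)) h.
  by have := fZ x 0 0; rewrite !scale0r => ->.
apply: (holomorphic_ratio oW (v := fun x => sqrt_map (frame t x) : L x)
    (w := fun x => sqrt_map (frame t' x))).
- have := (line_map_homogP (N := smooth_bundle N) (L := smooth_bundle N')
    (k := 0) (f := f) (@smooth_line_id _ _ _) (fun x => linear_scale (lf x))).1 sf.
  exact.
- by move=> x Wx; rewrite (coef_eq0 Nt' Wx.2) f0.
- by move=> x Wx; rewrite -qf [in LHS]fE // sqrt_mapZ.
- by move=> x [_ t'x]; have := frame_neq0 Nt' t'x; rewrite -sqrt_map_eq0.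
- move=> s Hs.
  apply: regular_sub (sqrt_regular_frame (@holomorphic_line_id _ _ _ _ J) Nt Hs).
  + by apply: openI => //; exact: tdom_open.
  + by apply: openI; exact: tdom_open.
  + by move=> y [[]].
- move=> s Hs.
  apply: regular_sub (sqrt_regular_frame (@holomorphic_line_id _ _ _ _ J) Nt' Hs).
  + by apply: openI => //; exact: tdom_open.
  + by apply: openI; exact: tdom_open.
  + by move=> y [[]].
Qed.

(** * The holomorphic atlas of a smooth root *)

Section HolomorphicRoot.
Variable N : square_root L.
Local Notation ltrivN := (ltriv (line_fibre R) (fun y => N y)).

Section Rescale.
Variables (t : ltrivN) (Nt : ltrivs (latlas N) t) (W : set M) (d : M -> R[i]).
Hypotheses (oW : open W) (Wt : W `<=` tdom t) (d0 : forall x, W x -> d x != 0).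

Lemma rescale_tfunK x : W x ->
  cancel (fun v : N x => coef t v / d x) (fun z => (z * d x) *: frame t x).
Proof. by move=> Wx v; rewrite divfK ?d0 // (coef_frameK Nt (Wt Wx)). Qed.

Lemma rescale_tinvK x : W x ->
  cancel (fun z => (z * d x) *: frame t x) (fun v : N x => coef t v / d x).
Proof.
move=> Wx z; have tx := Wt Wx.
by rewrite (coefZ Nt tx) (coef_frame tx) mulr1 mulfK // d0.
Qed.

Definition rescale : ltrivN :=
  @Ltriv _ _ (line_fibre R) (fun y => N y) W
    (fun x v => coef t v / d x) (fun x z => (z * d x) *: frame t x)
    oW rescale_tfunK rescale_tinvK.

End Rescale.

(** The frames are d e on an open W inside the domain of e. Shrinking to W is forced because the
    roots that yield d exist only locally; the sign left open in d is a holomorphic ambiguity. *)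
Definition holomorphic_trivs : set ltrivN := [set u |
  exists t W d (Nt : ltrivs (latlas N) t) (oW : open W) (Wt : W `<=` tdom t)
    (d0 : forall x, W x -> d x != 0),
  [/\ u = rescale Nt oW Wt d0, smooth_line M W (fun x _ => d x) &
      forall s, ltrivs (hatlas H) s -> holomorphic_line J (W `&` tdom s)
        (fun x _ => coef (N := LH) s (sqrt_map (d x *: frame t x)))]].

Lemma sqrt_smooth_hatlas t s : ltrivs (latlas N) t -> ltrivs (hatlas H) s ->
  smooth_line M (tdom t `&` tdom s) (fun x _ => coef (N := LH) s (sqrt_map (frame t x))).
Proof.
move=> Nt Hs.
have h : @line_map_regular _ _ _ _ L (smooth_bundle LH) (fun x v => v).
  exact: (hatlas_compat H).2.
have hq := line_map_comp (N := N) (N' := L) (N'' := smooth_bundle LH) _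
  (@sqrt_regular _ _ _ _ _ N) h.
exact: regular_one (hq _ t s Nt Hs).
Qed.

Lemma holomorphic_trivs_cover x : exists2 u, holomorphic_trivs u & tdom u x.
Proof.
have [t Nt tx] := ltriv_cover (latlas N) x.
have [s Hs sx] := ltriv_cover (hatlas H) x.
have oW : open (tdom t `&` tdom s) by apply: openI; exact: tdom_open.
pose c y := coef (N := LH) s (sqrt_map (frame t y)).
have c0 y : (tdom t `&` tdom s) y -> c y != 0.
  move=> [ty sy]; rewrite (coef_eq0 (N := LH) Hs sy).
  by have := frame_neq0 Nt ty; rewrite -sqrt_map_eq0.
have cx : c x != 0 by exact: c0.
have sc : smooth_over (atlas M) (@ofpair R) (tdom t `&` tdom s) (fun y _ => c y).
  exact: sqrt_smooth_hatlas.
have [||W [d [oW' W'x W'W sd dE]]] := smooth_over_local_sqrt oW _ _ cx sc.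
- exact: atlas_cover.
- by [].
have d0 y : W y -> d y != 0.
  by move=> Wy; have := c0 _ (W'W _ Wy); rewrite -dE // expf_eq0 /=.
have dV0 y : W y -> (d y)^-1 != 0 by move=> Wy; rewrite invr_eq0 d0.
have Wt : W `<=` tdom t by move=> y /W'W[].
exists (rescale Nt oW' Wt dV0) => //.
exists t, W, (fun y => (d y)^-1), Nt, oW', Wt, dV0; split=> //.
  by apply: smooth_overV => // y _; exact: d0.
(* As d^2 = c, the square map sends e / d to the frame of s itself, whose coordinate in s' is a
   transition function of the holomorphic atlas of L. *)
move=> s' Hs'; have oWs : open (W `&` tdom s') by apply: openI => //; exact: tdom_open.
have h : holomorphic_line J (W `&` tdom s')
    (fun y _ => coef (N := LH) s' (frame (N := LH) s y)).
  apply: regular_sub (regular_one (ltriv_regular Hs Hs')) => //.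
    by apply: openI; exact: tdom_open.
  by move=> y [/W'W[]].
apply: regular_congr h => // y z [Wy s'y]; have [ty sy] := W'W _ Wy.
congr (coef (N := LH) s' _); rewrite sqrt_mapZ.
rewrite -[in RHS](coef_frameK (N := LH) Hs sy (sqrt_map (frame t y))).
by rewrite scalerA -/(c y) -dE // exprVn mulVf ?expf_neq0 ?d0 // scale1r.
Qed.

Lemma holomorphic_trivs_linear u x : holomorphic_trivs u -> tdom u x ->
  scalar (tfun u (x := x)).
Proof.
move=> [t [W [d [Nt [oW [Wt [d0 [-> _ _]]]]]]]] Wx a v w /=.
by rewrite (coef_linear Nt (Wt _ Wx)) mulrDl mulrA.
Qed.

Lemma holomorphic_trivs_regular :
  regular_map (holomorphic_line J) holomorphic_trivs holomorphic_trivs (fun x v => v).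
Proof.
move=> _ _ [t [W [d [Nt [oW [Wt [d0 [-> sd hd]]]]]]]]
  [t' [W' [d' [Nt' [oW' [W't' [d'0 [-> sd' hd']]]]]]]] /=.
have oWW : open (W `&` W') by exact: openI.
(* The two rescaled frames satisfy d e = a (d' e'), so their images in L, both holomorphic, differ
   by a^2. *)
pose a x := d x * coef t' (frame t x) * (d' x)^-1.
have ha : holomorphic_line J (W `&` W') (fun x _ => a x).
  apply: (holomorphic_ratio oWW (v := fun x => sqrt_map (d x *: frame t x) : L x)
    (w := fun x => sqrt_map (d' x *: frame t' x))).
  - apply: smooth_over_mul => //.
      apply: smooth_over_mul => //.
        by apply: (regular_sub (O := smooth_line M)) sd => // y [].
      apply: (regular_sub (O := smooth_line M))
        (regular_one (ltriv_regular Nt Nt')) => //.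
        by apply: openI; exact: tdom_open.
      by move=> y [/Wt ? /W't'].
    apply: smooth_overV => // [x _ [_ W'x]|]; first exact: d'0.
    by apply: (regular_sub (O := smooth_line M)) sd' => // y [].
  - move=> x [Wx W'x]; rewrite !mulf_neq0 ?invr_eq0 ?d0 ?d'0 //.
    by rewrite (coef_eq0 Nt' (W't' _ W'x)) (frame_neq0 Nt (Wt _ Wx)).
  - move=> x [Wx W'x]; rewrite -sqrt_mapZ scalerA divfK ?d'0 // -scalerA.
    by rewrite (coef_frameK Nt' (W't' _ W'x)).
  - move=> x [Wx W'x]; rewrite sqrt_map_eq0 scaler_eq0 negb_or d'0 //.
    by rewrite (frame_neq0 Nt' (W't' _ W'x)).
  - move=> s Hs; have oWs : open (W `&` tdom s) by apply: openI => //; exact: tdom_open.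
    apply: regular_sub (hd s Hs) => //; last by move=> y [[]].
    by apply: openI => //; exact: tdom_open.
  - move=> s Hs; have oWs : open (W' `&` tdom s) by apply: openI => //; exact: tdom_open.
    apply: regular_sub (hd' s Hs) => //; last by move=> y [[]].
    by apply: openI => //; exact: tdom_open.
have h : holomorphic_line J (W `&` W') (fun x s => s * a x).
  exact: regular_mul oWW (@holomorphic_line_id _ _ _ _ J _) ha.
apply: regular_congr h => // x s [Wx W'x].
by rewrite (coefZ Nt' (W't' _ W'x)) /a !mulrA.
Qed.

Definition holomorphic_root_bundle : line_bundle (holomorphic_line J) :=
  LineBundle (LineAtlas holomorphic_trivs_cover holomorphic_trivs_linear
    holomorphic_trivs_regular).

Lemma holomorphic_root_regular :
  @line_map_regular _ _ _ _ holomorphic_root_bundle LH (fun x v => sqrt_map v).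
Proof.
apply/(line_map_homogP (k := 1) (@holomorphic_line_id _ _ _ _ J)).
  by move=> x a v; exact: (@sqrt_mapZ _ _ _ _ L N x a v).
move=> _ s [t [W [d [Nt [oW [Wt [d0 [-> sd hd]]]]]]]] Hs.
have oWs : open (W `&` tdom s) by apply: openI => //; exact: tdom_open.
by apply: regular_congr (hd s Hs) => // x z _; rewrite /frame /= mul1r.
Qed.

Definition holomorphic_root : square_root LH :=
  @SquareRoot _ _ _ _ LH holomorphic_root_bundle (fun x v => sqrt_map v)
    holomorphic_root_regular (@sqrt_surjective _ _ _ _ _ N) (@sqrt_quadratic _ _ _ _ _ N).

(** Smoothness of d makes the frames d e smooth for the original atlas of N; the converse direction
    comes from [smooth_line_iso]. *)
Lemma holomorphic_root_iso :
  @line_iso _ _ _ _ (smooth_root holomorphic_root) N (fun x v => v).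
Proof.
apply: smooth_line_iso => //.
apply/(line_map_homogP (k := 0) (@smooth_line_id _ _ _)) => //.
move=> _ t' [t [W [d [Nt [oW [Wt [d0 [-> sd hd]]]]]]]] Nt' /=.
have oWt : open (W `&` tdom t') by apply: openI => //; exact: tdom_open.
have h : smooth_line M (W `&` tdom t') (fun x _ => d x * coef t' (frame t x)).
  apply: regular_mul; first exact: oWt.
    by apply: (regular_sub (O := smooth_line M)) sd => // y [].
  apply: (regular_sub (O := smooth_line M))
    (regular_one (ltriv_regular Nt Nt')) => //.
    by apply: openI; exact: tdom_open.
  by move=> y [/Wt].
apply: regular_congr h => // x s [Wx t'x].
by rewrite -(coefZ Nt' t'x) /frame /= mul1r.
Qed.

Definition holomorphic_root_hom : sqrt_hom (smooth_root holomorphic_root) N :=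
  exist _ (fun x v => v) (conj holomorphic_root_iso (fun _ _ => erefl)).

End HolomorphicRoot.

Lemma holomorphic_sqrt_equivalent : equivalent (sqrt_category LH) (sqrt_category L).
Proof.
apply: (@equivalent_fully_faithful _ _ smooth_root_functor) => [N N'|N N' g|N].
- move=> f g fg; apply: sqrt_hom_eq => x v.
  exact: (congr1 (fun k => sval k x v) fg).
- case: g => f [lf qf].
  have hf : line_map_regular (f : forall x, N x -> N' x).
    exact: smooth_root_hom_holomorphic lf qf.
  have lif : line_iso (f : forall x, N x -> N' x).
    have [lin _ [f' ff' sf']] := lf; split=> //; exists f' => //.
    (* The inverse is again a smooth isomorphism compatible with the square maps. *)
    apply: smooth_root_hom_holomorphic.
      split=> [x a u v||]; first by apply: (can_inj (ff' x).1); rewrite lin !(ff' x).2.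
        exact: sf'.
      by exists f => [x|]; [have [] := ff' x|have [] := lf].
    by move=> x v; rewrite -[LHS](qf x) (ff' x).2.
  by exists (exist _ f (conj lif qf)); exact: sqrt_hom_eq.
- exists (holomorphic_root N); exact: sqrt_hom_isomorphic (holomorphic_root_hom N).
Qed.

End UnderlyingSmooth.

Theorem proposition24 (R : realType) (n : nat) (M : manifold R n)
    (Q : circle_bundle M) :
  let L := assoc_line_bundle Q in
  let Spin := spin_category Q in
  let HSqrt := hermitian_sqrt_category (assoc_metric Q) in
  let Sqrt := sqrt_category L in
  [/\ equivalent Spin HSqrt, equivalent Spin Sqrt & equivalent HSqrt Sqrt] /\
  (forall (m : nat) (J : complex_structure M m) (H : holomorphic_structure J L),
     let HolSqrt := sqrt_category (holomorphic_bundle H) in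
     [/\ equivalent HolSqrt Spin, equivalent HolSqrt HSqrt
       & equivalent HolSqrt Sqrt]).
Proof.
move=> L Spin HSqrt Sqrt.
have eS : equivalent Spin Sqrt := spin_sqrt_equivalent Q.
have eH : equivalent HSqrt Sqrt := hermitian_sqrt_equivalent (assoc_metric Q).
split=> [|m J H HolSqrt].
  by split=> //; exact: equivalent_trans eS (equivalent_sym eH).
have eO : equivalent HolSqrt Sqrt := holomorphic_sqrt_equivalent H.
split=> //; first exact: equivalent_trans eO (equivalent_sym eS).
exact: equivalent_trans eO (equivalent_sym eH).
Qed.
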